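(* Let $\alpha_0,\alpha_1>0$, $\alpha:=\alpha_1/\alpha_0$, and equip the real Stiefel manifold $\mathrm{St}_{\mathbb{R},p,n}$ with the metric induced by $\mathsf{g}_Y\omega=\alpha_0\omega+(\alpha_1-\alpha_0)YY^{T}\omega$. Let $\tilde Y,Z\in\mathrm{St}_{\mathbb{R},p,n}$ and let $Q\in\mathbb{R}^{n\times k}$ have columns forming an orthonormal basis of the column span of $Z-\tilde Y\tilde Y^{T}Z$ ($k\le p$ is its rank). For $(A,R)\in\mathrm{Skew}_p\times\mathbb{R}^{k\times p}$, where $\mathrm{Skew}_p$ is the space of real antisymmetric $p\times p$ matrices, let $Y(t)$ be the geodesic with $Y(0)=\tilde Y$ and $\dot Y(0)=\eta:=\tilde YA+QR$. Define $$\mathtt F(A,R):=\tfrac12\mathrm{Tr}\big((Y(1)-Z)^{T}(Y(1)-Z)\big)-p.$$ With $\hat A:=\begin{bmatrix}2\alpha A&-R^{T}\\R&0\end{bmatrix}\in\mathbb{R}^{(p+k)\times(p+k)}$ and $I_{p+k,p}:=\begin{bmatrix}I_p\\0_{k\times p}\end{bmatrix}$, we have $$\mathtt F(A,R)=-\mathrm{Tr}\,Z^{T}Y(1)=-\mathrm{Tr}\,Z^{T}[\tilde Y\ Q]\,(\exp\hat A)\,I_{p+k,p}\exp((1-2\alpha)A).$$ Set $$\mathring L:=\mathrm{L}_{\exp}\big((1-2\alpha)A,\;Z^{T}[\tilde Y\ Q](\exp\hat A)I_{p+k,p}\big),\qquad \hat L=\begin{bmatrix}\hat L_{11}&\hat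 L_{12}\\\hat L_{21}&\hat L_{22}\end{bmatrix}:=\mathrm{L}_{\exp}\big(\hat A,\;I_{p+k,p}\exp((1-2\alpha)A)\,Z^{T}[\tilde Y\ Q]\big),$$ where the block structure of $\hat L$ mirrors that of $\hat A$. Then the gradient $\nabla\mathtt F=(\nabla_A\mathtt F,\nabla_R\mathtt F)$ is given by $$\nabla_A\mathtt F=(1-2\alpha)\,\mathrm{skew}(\mathring L)+2\alpha\,\mathrm{skew}(\hat L_{11}),\qquad \nabla_R\mathtt F=\hat L_{21}-\hat L_{12}^{T}.$$
   Context: $\mathrm{St}_{\mathbb{R},p,n}=\{Y\in\mathbb{R}^{n\times p}:Y^{T}Y=I_p\}$, with tangent vectors at $Y$ the matrices $\eta\in\mathbb{R}^{n\times p}$ such that $Y^{T}\eta$ is antisymmetric, and Riemannian metric $\langle\omega_1,\omega_2\rangle_Y=\mathrm{Tr}\,\omega_1^{T}(\alpha_0\omega_2+(\alpha_1-\alpha_0)YY^{T}\omega_2)$. $\mathrm{skew}(B)=\frac12(B-B^{T})$. $\mathrm{L}_f(X,E)=\lim_{h\to0}\frac1h(f(X+hE)-f(X))$ is the Fréchet derivative of the matrix function $f$ at the square matrix $X$ in direction $E$; $\mathrm{L}_{\exp}$ is that of the matrix exponential. The gradient is taken on the Euclidean space $\mathrm{Skew}_p\times\mathbb{R}^{k\times p}$ with the Frobenius inner product $\langle(A_1,R_1),(A_2,R_2)\rangle=\mathrm{Tr}A_1^{T}A_2+\mathrm{Tr}R_1^{T}R_2$. *)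

(* Defs.v *)
From HB Require Import structures.
From mathcomp Require Import all_boot all_order all_algebra.
From mathcomp Require Import all_classical all_reals all_analysis.

Set Implicit Arguments.
Unset Strict Implicit.
Unset Printing Implicit Defensive.

Import Order.TTheory GRing.Theory Num.Theory.
Import numFieldNormedType.Exports.

Local Open Scope classical_set_scope.
Local Open Scope ring_scope.

Definition antisym {K : realType} {p : nat} (B : 'M[K]_p) : Prop := B^T = - B.

Definition skew_part {K : realType} {p : nat} (B : 'M[K]_p) : 'M[K]_p :=
  2^-1 *: (B - B^T).

Definition expmx {K : realType} {m : nat} (X : 'M[K]_m) : 'M[K]_m :=
  limn (series (fun j : nat => (j`!%:R)^-1 *: X ^+ j)).

(* ['D_E f X] is the limit of [h^-1 *: (f (h *: E + X) - f X)] as [h] tends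
   to 0, [h != 0]. *)
Definition Lexp {K : realType} {m : nat} (X E : 'M[K]_m) : 'M[K]_m :=
  'D_E (@expmx K m) X.

Section Stiefel.
Context {K : realType} {n p : nat}.
Implicit Types (Y eta omega : 'M[K]_(n, p)).

Definition stiefel Y : Prop := Y^T *m Y = 1%:M.

Definition tangent Y eta : Prop := antisym (Y^T *m eta).

Definition metric (alpha0 alpha1 : K) Y omega1 omega2 : K :=
  \tr (omega1^T *m
       (alpha0 *: omega2 + (alpha1 - alpha0) *: (Y *m Y^T *m omega2))).

(* Vector fields on the Stiefel manifold are given by maps of the ambient
   matrix space; only their values at points of the manifold, and their
   derivatives there along tangent directions, are ever used. *)
Definition tangent_field (X : 'M[K]_(n, p) -> 'M[K]_(n, p)) : Prop :=
  forall Y, stiefel Y -> differentiable X Y /\ tangent Y (X Y).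

(* A connection on a submanifold of a vector space is the ambient directional
   derivative plus a correction [Gamma Y] that is bilinear on the tangent
   space at [Y] (its Christoffel function). *)
Definition covariant (Gamma : 'M[K]_(n, p) -> 'M[K]_(n, p) -> 'M[K]_(n, p) ->
    'M[K]_(n, p)) (X V : 'M[K]_(n, p) -> 'M[K]_(n, p)) Y : 'M[K]_(n, p) :=
  'd V Y (X Y) + Gamma Y (X Y) (V Y).

Record levi_civita (alpha0 alpha1 : K)
    (Gamma : 'M[K]_(n, p) -> 'M[K]_(n, p) -> 'M[K]_(n, p) -> 'M[K]_(n, p)) :
    Prop := LeviCivita {
  lc_linearl : forall Y (c : K) omega1 omega2 eta, stiefel Y ->
    tangent Y omega1 -> tangent Y omega2 -> tangent Y eta ->
    Gamma Y (c *: omega1 + omega2) eta =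
    c *: Gamma Y omega1 eta + Gamma Y omega2 eta;
  lc_linearr : forall Y (c : K) omega eta1 eta2, stiefel Y ->
    tangent Y omega -> tangent Y eta1 -> tangent Y eta2 ->
    Gamma Y omega (c *: eta1 + eta2) =
    c *: Gamma Y omega eta1 + Gamma Y omega eta2;
  lc_tangent : forall X V, tangent_field X -> tangent_field V ->
    forall Y, stiefel Y -> tangent Y (covariant Gamma X V Y);
  (* the right-hand side is the Lie bracket of [X] and [V] *)
  lc_torsion_free : forall X V, tangent_field X -> tangent_field V ->
    forall Y, stiefel Y ->
    covariant Gamma X V Y - covariant Gamma V X Y =
    'd V Y (X Y) - 'd X Y (V Y);
  lc_metric : forall X V W,
    tangent_field X -> tangent_field V -> tangent_field W ->
    forall Y, stiefel Y ->
    'd (fun Y' => metric alpha0 alpha1 Y' (V Y') (W Y')) Y (X Y) =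
    metric alpha0 alpha1 Y (covariant Gamma X V Y) (W Y) +
    metric alpha0 alpha1 Y (V Y) (covariant Gamma X W Y)
}.

(* A curve in the manifold whose velocity is parallel along the curve for the
   Levi-Civita connection. *)
Definition is_geodesic (alpha0 alpha1 : K) (c : K -> 'M[K]_(n, p)) : Prop :=
  [/\ forall t, stiefel (c t),
      forall t, derivable c t 1 /\ derivable (derive1 c) t 1 &
      exists2 Gamma, levi_civita alpha0 alpha1 Gamma &
        forall t, derive1 (derive1 c) t + Gamma (c t) (derive1 c t) (derive1 c t) = 0].

(* The geodesic starting at [Y] with velocity [eta]; the default value of
   [get] is irrelevant, since the Stiefel manifold is complete and geodesics
   are determined by their initial data. *)
Definition geodesic (alpha0 alpha1 : K) Y eta : K -> 'M[K]_(n, p) :=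
  get [set c | [/\ is_geodesic alpha0 alpha1 c, c 0 = Y & derive1 c 0 = eta]].

End Stiefel.

Definition inner {K : realType} {p k : nat} (H1 H2 : 'M[K]_p * 'M[K]_(k, p)) : K :=
  \tr (H1.1^T *m H2.1) + \tr (H1.2^T *m H2.2).

(* [G] is the gradient at [x] of the restriction of [F] to the Euclidean space
   of pairs whose first component is antisymmetric: [G] lies in that space and
   represents the Frechet derivative for the inner product. *)
Definition is_gradient {K : realType} {p k : nat}
    (F : 'M[K]_p * 'M[K]_(k, p) -> K) (x G : 'M[K]_p * 'M[K]_(k, p)) : Prop :=
  antisym G.1 /\
  forall e : K, 0 < e ->
    \forall H \near within [set H : 'M[K]_p * 'M[K]_(k, p) | antisym H.1]
                           (nbhs (0 : 'M[K]_p * 'M[K]_(k, p))),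
      `|F (x + H) - F x - inner G H| <= e * Num.sqrt (inner H H).

(* Main.v *)
(* On tangent vectors a Levi-Civita connection is unique, so its Christoffel
   function is
     x, v |-> Y (x^T v + v^T x) / 2 + (1 - alpha) (I - Y Y^T) (x v^T + v x^T) Y.
   Along a geodesic c this makes c^T c' a constant A; after multiplication by
   exp (- t (1 - 2 alpha) A) on the right, the pair formed by c and c' - c A
   solves a linear equation with constant coefficients, hence a geodesic is
   determined by its initial data and [geodesic] is the explicit curve
   [Yt Q] exp (t Ahat) I exp (t (1 - 2 alpha) A).
   The gradient then follows from the Frechet differentiability of exp, whose
   differential is self-adjoint: tr (L (X, E) G) = tr (E L (X, G)). *)
Require Import Defs.
From HB Require Import structures.
From mathcomp Require Import all_boot all_order all_algebra.
From mathcomp Require Import all_classical all_reals all_analysis.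
From mathcomp Require Import ring lra.
Import Order.TTheory GRing.Theory Num.Theory.
Import numFieldNormedType.Exports.
Local Open Scope classical_set_scope.
Local Open Scope ring_scope.

Set Implicit Arguments.
Unset Strict Implicit.
Unset Printing Implicit Defensive.

(** Both definitions behind [geodesic] are indirect: [is_geodesic] lets each curve bring its own
    [Gamma], and [geodesic] selects a curve by choice. So the explicit curve must be shown to be a
    geodesic, which takes a proof that the Christoffel function above is Levi-Civita, and then to be
    the only one, whatever [Gamma] a competitor uses. The geodesic equation sees [Gamma Y x x] only,
    so uniqueness on the diagonal suffices. Linearization works because, besides c^T c', the Gram
    matrix of the rotated vector c' - c A is conserved, and it is the only nonlinear coefficient
    left. The function of the theorem is under control only where [A] is antisymmetric. The
    derivative is therefore computed for the closed formula, which is smooth on all pairs, and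
    restricted afterwards. *)

HB.instance Definition _ (K : realType) (m n : nat) := Complete.on 'M[K]_(m, n).

(** * Max norm, traces and differential calculus of matrix-valued maps *)

Section MatrixCalculus.
Context {K : realType}.

Lemma mx_norm_le m n (M : 'M[K]_(m, n)) (c : K) :
  0 <= c -> (forall i j, `|M i j| <= c) -> `|M| <= c.
Proof.
move=> c0 Mc; rewrite [leLHS]/Num.Def.normr/= mx_normrE.
by apply: bigmax_le => // -[i j] _ /=.
Qed.

Lemma mx_norm_ge m n (M : 'M[K]_(m, n)) i j : `|M i j| <= `|M|.
Proof.
rewrite [leRHS]/Num.Def.normr/= mx_normrE.
exact: (le_bigmax _ (fun ij : 'I_m * 'I_n => `|M ij.1 ij.2|) (i, j)).
Qed.

(** The norm is the largest entry in absolute value, so it is submultiplicative only up to the inner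
    dimension. This is why the bounds on powers below control [m%:R] times the norm of [X]. *)
Lemma mx_normM m n p (A : 'M[K]_(m, n)) (B : 'M[K]_(n, p)) :
  `|A *m B| <= n%:R * `|A| * `|B|.
Proof.
apply: mx_norm_le => [|i j]; first by rewrite !mulr_ge0.
rewrite mxE (le_trans (ler_norm_sum _ _ _))//.
apply: (@le_trans _ _ (\sum_(k < n) `|A| * `|B|)).
  by apply: ler_sum => k _; rewrite normrM ler_pM ?mx_norm_ge.
by rewrite sumr_const card_ord -[leLHS]mulr_natl mulrA.
Qed.

Lemma trmxD (m q : nat) (A B : 'M[K]_(m, q)) : (A + B)^T = A^T + B^T.
Proof. exact: raddfD. Qed.

Lemma trmxN (m q : nat) (A : 'M[K]_(m, q)) : (- A)^T = - A^T.
Proof. exact: raddfN. Qed.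

Lemma trmxB (m q : nat) (A B : 'M[K]_(m, q)) : (A - B)^T = A^T - B^T.
Proof. exact: raddfB. Qed.

Lemma trmxZ (m q : nat) (a : K) (A : 'M[K]_(m, q)) : (a *: A)^T = a *: A^T.
Proof. exact: linearZ. Qed.

Lemma mxtraceN (q : nat) (M : 'M[K]_q) : \tr (- M) = - \tr M.
Proof. exact: raddfN. Qed.

Lemma mxD2 (q r : nat) (M : 'M[K]_(q, r)) : M + M = 2 *: M.
Proof. by rewrite scaler_nat mulr2n. Qed.

Lemma mxtrace_normsq (m q : nat) (M : 'M[K]_(m, q)) :
  \tr (M^T *m M) = \sum_i \sum_j M j i ^+ 2.
Proof.
apply: eq_bigr => i _; rewrite !mxE; apply: eq_bigr => j _.
by rewrite mxE expr2.
Qed.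

Lemma mxtrace_normsq_ge0 (m q : nat) (M : 'M[K]_(m, q)) : 0 <= \tr (M^T *m M).
Proof.
rewrite mxtrace_normsq; apply: sumr_ge0 => i _; apply: sumr_ge0 => j _.
by rewrite sqr_ge0.
Qed.

Lemma mxtrace_normsq_eq0 (m q : nat) (M : 'M[K]_(m, q)) :
  \tr (M^T *m M) = 0 -> M = 0.
Proof.
rewrite mxtrace_normsq => /eqP.
rewrite psumr_eq0 => [|i _]; last by apply: sumr_ge0 => j _; rewrite sqr_ge0.
move=> /allP M0; apply/matrixP => j i; rewrite mxE.
have := M0 i; rewrite mem_index_enum => /(_ isT) /=.
rewrite psumr_eq0 => [|k _]; last by rewrite sqr_ge0.
move=> /allP/(_ j); rewrite mem_index_enum => /(_ isT) /=.
by rewrite sqrf_eq0 => /eqP.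
Qed.

Lemma mxtrace_sym_antisym (q : nat) (S B : 'M[K]_q) :
  S^T = S -> antisym B -> \tr (S *m B) = 0.
Proof.
move=> SS BA; have : \tr (S *m B) = - \tr (S *m B).
  by rewrite -[LHS]mxtrace_tr trmx_mul SS BA mulNmx linearN/= mxtrace_mulC.
lra.
Qed.

Lemma is_derive_mxP m n (V : normedModType K) (f : V -> 'M[K]_(m, n))
    (x v : V) (df : 'M[K]_(m, n)) :
  is_derive x v f df <->
  forall i j, is_derive x v (fun y => f y i j) (df i j).
Proof.
split=> [fdf i j|fdf].
  have fd : derivable f x v by [].
  apply: DeriveDef; first by move/derivable_mxP : fd.
  by rewrite -(@derive_val _ _ _ _ _ _ _ fdf) derive_mx// mxE.
have fd : derivable f x v by apply/derivable_mxP => i j.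
apply: DeriveDef => //; rewrite derive_mx//.
by apply/matrixP => i j; rewrite mxE derive_val.
Qed.

Lemma is_derive_bigsum (V W : normedModType K) (I : finType) (x v : V)
    (f : I -> V -> W) (df : I -> W) :
  (forall i, is_derive x v (f i) (df i)) ->
  is_derive x v (fun y => \sum_i f i y) (\sum_i df i).
Proof.
move=> fdf; rewrite (_ : (fun y => _) = \sum_i f i); last first.
  by apply/funext => y; rewrite fct_sumE.
elim/big_rec2 : _ => [|i s g _ IH]; first exact: is_derive_cst.
exact: is_deriveD.
Qed.

Lemma is_derive_mulmx m n p (V : normedModType K) (f : V -> 'M[K]_(m, n))
    (g : V -> 'M[K]_(n, p)) (x v : V) df dg :
  is_derive x v f df -> is_derive x v g dg ->
  is_derive x v (fun y => f y *m g y) (df *m g x + f x *m dg).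
Proof.
move=> /is_derive_mxP fdf /is_derive_mxP gdg; apply/is_derive_mxP => i j.
under eq_fun do rewrite mxE.
apply: is_derive_eq; first by apply: is_derive_bigsum => k; exact: is_deriveM.
rewrite !mxE -big_split; apply: eq_bigr => k _ /=.
by rewrite addrC; congr +%R; rewrite [LHS]mulrC.
Qed.

Lemma is_derive_trmx m n (V : normedModType K) (f : V -> 'M[K]_(m, n))
    (x v : V) df :
  is_derive x v f df -> is_derive x v (fun y => (f y)^T) df^T.
Proof.
move=> /is_derive_mxP fdf; apply/is_derive_mxP => i j.
by under eq_fun do rewrite mxE; rewrite mxE.
Qed.

Lemma is_derive_mxtrace m (V : normedModType K) (f : V -> 'M[K]_m)
    (x v : V) df :
  is_derive x v f df -> is_derive x v (fun y => \tr (f y)) (\tr df).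
Proof. by move=> /is_derive_mxP fdf; apply: is_derive_bigsum. Qed.

Lemma is_derive_mulmxl m n p (V : normedModType K) (A : 'M[K]_(m, n))
    (f : V -> 'M[K]_(n, p)) (x v : V) df :
  is_derive x v f df -> is_derive x v (fun y => A *m f y) (A *m df).
Proof.
move=> fdf; have := is_derive_mulmx (is_derive_cst A x v) fdf.
by rewrite mul0mx add0r.
Qed.

Lemma is_derive_mulmxr m n p (V : normedModType K) (A : 'M[K]_(n, p))
    (f : V -> 'M[K]_(m, n)) (x v : V) df :
  is_derive x v f df -> is_derive x v (fun y => f y *m A) (df *m A).
Proof.
move=> fdf; have := is_derive_mulmx fdf (is_derive_cst A x v).
by rewrite mulmx0 addr0.
Qed.

Lemma is_derive_row_mx (q r1 r2 : nat) (W : normedModType K)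
    (f : W -> 'M[K]_(q, r1)) (g : W -> 'M[K]_(q, r2)) (x v : W) df dg :
  is_derive x v f df -> is_derive x v g dg ->
  is_derive x v (fun y => row_mx (f y) (g y)) (row_mx df dg).
Proof.
move=> /is_derive_mxP fd /is_derive_mxP gd; apply/is_derive_mxP => i j.
rewrite mxE; under eq_fun do rewrite mxE.
by case: (fintype.split j).
Qed.

(** The hypothesis makes the two difference quotients the same function of [h], so directional
    derivability of [f] alone is enough. *)
Lemma is_derive_affine_comp (U V W : normedModType K) (L : U -> V)
    (f : V -> W) (x v : U) (w : V) d :
  (forall h : K, L (h *: v + x) = h *: w + L x) ->
  is_derive (L x) w f d -> is_derive x v (fun y => f (L y)) d.
Proof.
move=> LE [fd fE].
have E : (fun h : K =>
             h^-1 *: (((fun y => f (L y)) \o shift x) (h *: v) - f (L x))) =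
         (fun h => h^-1 *: ((f \o shift (L x)) (h *: w) - f (L x))).
  by apply/funext => h /=; rewrite LE.
by split; rewrite -?fE /derivable /derive E.
Qed.

Lemma is_derive0_mx_cst m n (f : K -> 'M[K]_(m, n)) (x y : K) :
  (forall t : K, is_derive t 1 f 0) -> f x = f y.
Proof.
move=> f0; apply/matrixP => i j.
apply: (@is_derive_0_is_cst _ (fun t => f t i j)) => t.
by have /is_derive_mxP/(_ i j) := f0 t; rewrite mxE.
Qed.

Lemma is_derive_comp_diff (U W' : normedModType K) (f : U -> W') (c : K -> U)
    (t : K) dc :
  is_derive t 1 c dc -> differentiable f (c t) ->
  is_derive t 1 (fun s => f (c s)) ('d f (c t) dc).
Proof.
move=> cdc fd; have cd : differentiable c t by apply/derivable1_diffP.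
have fcd : differentiable (f \o c) t by exact: differentiable_comp.
apply: DeriveDef; first exact/diff_derivable.
rewrite deriveE// diff_comp//= -[X in 'd c t X]/(1 : K) -(deriveE _ cd).
by rewrite derive_val.
Qed.

Lemma is_derive_diff (U W' : normedModType K) (f : U -> W') (u v : U) :
  differentiable f u -> is_derive u v f ('d f u v).
Proof.
by move=> fd; apply: DeriveDef; [exact: diff_derivable|rewrite deriveE].
Qed.

Lemma is_derive_unique (U W' : normedModType K) (f : U -> W') (u v : U) d e :
  is_derive u v f d -> is_derive u v f e -> d = e.
Proof.
move=> fd fe; rewrite -(@derive_val _ _ _ _ _ _ _ fd).
exact: (@derive_val _ _ _ _ _ _ _ fe).
Qed.

Lemma is_derive_derive1 (W : normedModType K) (f : K -> W) (t : K) :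
  derivable f t 1 -> is_derive t 1 f (f^`()%classic t).
Proof. by move=> fd; rewrite derive1E; exact: derivableP. Qed.

Lemma derive1_is_derive (W : normedModType K) (f : K -> W) (t : K) d :
  is_derive t 1 f d -> f^`()%classic t = d.
Proof. by move=> fd; rewrite derive1E; exact: derive_val. Qed.

Lemma differentiable_bigsum (V W : normedModType K) (I : finType) (x : V)
    (f : I -> V -> W) :
  (forall i, differentiable (f i) x) ->
  differentiable (fun y => \sum_i f i y) x.
Proof.
move=> fd.
rewrite (_ : (fun y => _) = \sum_i f i); last first.
  by apply/funext => y; rewrite fct_sumE.
elim/big_ind : _ => //.
by move=> g h; exact: differentiableD.
Qed.

Lemma differentiable_mx m n (V : normedModType K) (f : V -> 'M[K]_(m, n)) x :
  (forall i j, differentiable (fun y => f y i j) x) -> differentiable f x.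
Proof.
move=> fd.
rewrite (_ : f = fun y => \sum_i \sum_j f y i j *: delta_mx i j); last first.
  by apply/funext => y; exact: matrix_sum_delta.
apply: differentiable_bigsum => i; apply: differentiable_bigsum => j.
exact: differentiableZl.
Qed.

Lemma differentiable_entry m n (V : normedModType K) (f : V -> 'M[K]_(m, n)) x
    i j :
  differentiable f x -> differentiable (fun y => f y i j) x.
Proof.
move=> fd; apply: (@differentiable_comp _ _ _ _ f (fun M => M i j)) => //.
exact: differentiable_coord.
Qed.

Lemma differentiable_mulmx m n p (V : normedModType K) (f : V -> 'M[K]_(m, n))
    (g : V -> 'M[K]_(n, p)) x :
  differentiable f x -> differentiable g x ->
  differentiable (fun y => f y *m g y) x.
Proof.
move=> fd gd; apply: differentiable_mx => i j; under eq_fun do rewrite mxE.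
apply: differentiable_bigsum => k.
by apply: differentiableM; exact: differentiable_entry.
Qed.

Lemma differentiable_trmx m n (V : normedModType K) (f : V -> 'M[K]_(m, n)) x :
  differentiable f x -> differentiable (fun y => (f y)^T) x.
Proof.
move=> fd; apply: differentiable_mx => i j; under eq_fun do rewrite mxE.
exact: differentiable_entry.
Qed.

Lemma differentiable_mxtrace m (V : normedModType K) (f : V -> 'M[K]_m) x :
  differentiable f x -> differentiable (fun y => \tr (f y)) x.
Proof.
by move=> fd; apply: differentiable_bigsum => i; exact: differentiable_entry.
Qed.

(** A linear map on matrices is a finite combination of coordinate functions, so differentiability,
    and with it continuity, is automatic. *)
Lemma differentiable_linear_mx m n (W : normedModType K)
    (L : {linear 'M[K]_(m, n) -> W}) X : differentiable L X.
Proof.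
rewrite (_ : (L : _ -> _) = fun Y => \sum_i \sum_j Y i j *: L (delta_mx i j)).
  apply: differentiable_bigsum => i; apply: differentiable_bigsum => j.
  apply: differentiableZl; exact: differentiable_coord.
apply/funext => Y; rewrite [in LHS](matrix_sum_delta Y) linear_sum.
by apply: eq_bigr => i _; rewrite linear_sum; apply: eq_bigr => j _; rewrite linearZ.
Qed.

Lemma linear_mx_continuous m n (W : normedModType K)
    (L : {linear 'M[K]_(m, n) -> W}) : continuous L.
Proof. by move=> X; apply/differentiable_continuous/differentiable_linear_mx. Qed.

End MatrixCalculus.

(** * The matrix exponential *)

Section ExpSeries.
Context {K : realType} {m n : nat}.
Implicit Types u v : nat -> 'M[K]_(m, n).

(** Left open in [u] because three such series occur: the exponential, its differential, and the
    second-order remainder. *)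
Definition expseries u : 'M[K]_(m, n) :=
  limn (series (fun j : nat => (j`!%:R)^-1 *: u j)).

Definition geo_bounded (C b : K) u := forall j, `|u j| <= C * b ^+ j.

Lemma geo_bounded_coeff C b u j : 0 <= b -> geo_bounded C b u ->
  `|(j`!%:R)^-1 *: u j| <= (C *: exp_coeff b) j.
Proof.
move=> b0 ub; rewrite normrZ normfV ger0_norm// /exp_coeff/=.
rewrite -[leRHS]/(C * (b ^+ j / j`!%:R)) mulrA [leRHS]mulrC.
by rewrite ler_wpM2l.
Qed.

Lemma is_cvg_expseries C b u : 0 <= b -> geo_bounded C b u ->
  cvgn [normed series (fun j : nat => (j`!%:R)^-1 *: u j)].
Proof.
move=> b0 ub; apply: (@series_le_cvg _ _ (C *: exp_coeff b)) => [j|j|j|].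
- exact: normr_ge0.
- exact: le_trans (geo_bounded_coeff j b0 ub).
- exact: geo_bounded_coeff.
- exact/is_cvg_seriesZ/is_cvg_series_exp_coeff.
Qed.

Lemma cvg_expseries C b u : 0 <= b -> geo_bounded C b u ->
  series (fun j : nat => (j`!%:R)^-1 *: u j) @ \oo --> expseries u.
Proof. by move=> b0 ub; apply/normed_cvg/(is_cvg_expseries b0 ub). Qed.

Lemma norm_expseries C b u : 0 <= b -> geo_bounded C b u ->
  `|expseries u| <= C * expR b.
Proof.
move=> b0 ub; apply: le_trans (lim_series_norm (is_cvg_expseries b0 ub)) _.
have cb : cvgn (series (C *: exp_coeff b)).
  exact/is_cvg_seriesZ/is_cvg_series_exp_coeff.
rewrite -[leRHS]/(C *: expR b) /expR -lim_seriesZ; last first.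
  exact: is_cvg_series_exp_coeff.
apply: ler_lim => //; first exact: is_cvg_expseries ub.
apply: nearW => k; apply: ler_sum => j _.
exact: geo_bounded_coeff.
Qed.

Lemma expseriesD C b u D c v : 0 <= b -> geo_bounded C b u ->
    0 <= c -> geo_bounded D c v ->
  expseries (u \+ v) = expseries u + expseries v.
Proof.
move=> b0 ub c0 vc; apply: cvg_lim => //.
rewrite (_ : series _ = series (fun j => (j`!%:R)^-1 *: u j) \+
                        series (fun j => (j`!%:R)^-1 *: v j)); last first.
  apply/funext => k; rewrite /series/= -big_split/=.
  by apply: eq_bigr => j _; rewrite scalerDr.
exact: cvgD (cvg_expseries b0 ub) (cvg_expseries c0 vc).
Qed.

End ExpSeries.

Lemma expseries_linear (K : realType) m n p q (C b : K)
    (L : {linear 'M[K]_(m, n) -> 'M[K]_(p, q)}) u :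
  0 <= b -> geo_bounded C b u -> expseries (L \o u) = L (expseries u).
Proof.
move=> b0 ub; apply: cvg_lim => //.
rewrite (_ : series _ = L \o series (fun j => (j`!%:R)^-1 *: u j)); last first.
  apply/funext => k; rewrite /series/= linear_sum.
  by apply: eq_bigr => j _ /=; rewrite linearZ.
apply: continuous_cvg; last exact: cvg_expseries ub.
exact: linear_mx_continuous.
Qed.

Lemma cvg_linear_expseries (K : realType) m n (C b : K)
    (L : {linear 'M[K]_(m, n) -> K}) u :
  0 <= b -> geo_bounded C b u ->
  series (fun j => (j`!%:R)^-1 * L (u j)) @ \oo --> L (expseries u).
Proof.
move=> b0 ub.
rewrite (_ : series _ = L \o series (fun j => (j`!%:R)^-1 *: u j)); last first.
  apply/funext => k; rewrite /series/= linear_sum.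
  by apply: eq_bigr => j _ /=; rewrite linearZ.
apply: continuous_cvg; last exact: cvg_expseries ub.
exact: linear_mx_continuous.
Qed.

(** * Fréchet differential of the exponential, and one-parameter groups *)

Section Dexp.
Context {K : realType} {m : nat}.
Implicit Types X E G : 'M[K]_m.

(* The differential of the j-th power: the sum of X^a E X^b over a + b = j - 1. *)
Fixpoint dpow X E j : 'M[K]_m :=
  if j is i.+1 then X *m dpow X E i + E *m X ^+ i else 0.

Definition dexp X E := expseries (dpow X E).

Lemma mxexprS X j : X ^+ j.+1 = X *m X ^+ j. Proof. by rewrite exprS. Qed.

Lemma mxexprSr X j : X ^+ j.+1 = X ^+ j *m X. Proof. by rewrite exprSr. Qed.

Lemma mx_norm_expr (r : K) X j : m%:R * `|X| <= r -> `|X ^+ j| <= r ^+ j.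
Proof.
move=> Xr; have r0 : 0 <= r by apply: le_trans Xr; rewrite mulr_ge0.
elim: j => [|j IH].
  rewrite !expr0; apply: mx_norm_le => // i k.
  by rewrite mxE; case: (i == k); rewrite ?normr1 ?normr0.
rewrite mxexprS exprS (le_trans (mx_normM _ _))// ler_pM// mulr_ge0//.
Qed.

Lemma geo_bounded_expr (r : K) X : 0 <= r -> m%:R * `|X| <= r ->
  geo_bounded 1 (2 * r) (fun j => X ^+ j).
Proof.
move=> r0 Xr j; rewrite mul1r (le_trans (mx_norm_expr _ Xr))//.
by rewrite lerXn2r ?nnegrE ?mulr_ge0// ler_peMl// ler1n.
Qed.

(** This recursion is obeyed by [dpow] and by the increment [(X + E) ^+ j - X ^+ j], both driven by
    powers, and by the second-order remainder, driven by the increment; each use gains a factor [e].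
    The ratio is [2 * r] because [r + 1 <= 2 * r] absorbs the driving term. *)
Lemma geo_bounded_rec (C r e : K) X E (v w : nat -> 'M[K]_m) :
    1 <= r -> m%:R * `|X| <= r -> m%:R * `|E| <= e ->
    geo_bounded C (2 * r) v ->
    w 0%N = 0 -> (forall j, w j.+1 = X *m w j + E *m v j) ->
  geo_bounded (e * C) (2 * r) w.
Proof.
move=> r1 Xr Ee vb w0 wS j; have r0 : 0 <= r by rewrite (le_trans ler01).
have e0 : 0 <= e by apply: le_trans Ee; rewrite mulr_ge0.
have C0 : 0 <= C by have := vb 0%N; rewrite expr0 mulr1; exact: le_trans.
have q0 k : 0 <= (2 * r) ^+ k by rewrite exprn_ge0// mulr_ge0.
elim: j => [|j IH] /=; first by rewrite w0 normr0 expr0 mulr1 mulr_ge0.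
apply: (@le_trans _ _ (r * (e * C * (2 * r) ^+ j) + e * (C * (2 * r) ^+ j))).
  rewrite wS; apply: (le_trans (ler_normD _ _)); apply: lerD;
    apply: (le_trans (mx_normM _ _)); apply: ler_pM; rewrite ?mulr_ge0//.
apply: (@le_trans _ _ (r * (e * C * (2 * r) ^+ j) + r * (e * C * (2 * r) ^+ j))).
  by rewrite lerD2l mulrA ler_peMl// !mulr_ge0.
by rewrite exprS le_eqVlt; apply/orP; left; apply/eqP; ring.
Qed.

Lemma geo_bounded_dpow (r e : K) X E : 1 <= r ->
    m%:R * `|X| <= r -> m%:R * `|E| <= e ->
  geo_bounded e (2 * r) (dpow X E).
Proof.
move=> r1 Xr Ee; rewrite -[e]mulr1.
apply: (geo_bounded_rec r1 Xr Ee (v := fun j => X ^+ j)) => //.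
by apply: geo_bounded_expr => //; rewrite (le_trans ler01).
Qed.

Lemma geo_bounded_dexpr (r e : K) X E : 1 <= r ->
    m%:R * `|X| <= r -> m%:R * `|E| <= e -> m%:R * `|X + E| <= r ->
  geo_bounded e (2 * r) (fun j => (X + E) ^+ j - X ^+ j).
Proof.
move=> r1 Xr Ee XEr; rewrite -[e]mulr1.
apply: (geo_bounded_rec r1 Xr Ee (v := fun j => (X + E) ^+ j)) => [||j].
- by apply: geo_bounded_expr => //; rewrite (le_trans ler01).
- by rewrite !expr0 subrr.
- by rewrite !mxexprS mulmxBr mulmxDl addrAC.
Qed.

Lemma geo_bounded_dexpr2 (r e : K) X E : 1 <= r ->
    m%:R * `|X| <= r -> m%:R * `|E| <= e -> m%:R * `|X + E| <= r ->
  geo_bounded (e * e) (2 * r) (fun j => (X + E) ^+ j - X ^+ j - dpow X E j).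
Proof.
move=> r1 Xr Ee XEr.
apply: (geo_bounded_rec r1 Xr Ee (geo_bounded_dexpr r1 Xr Ee XEr)) => [|j].
  by rewrite !expr0 subrr /= subr0.
rewrite !mxexprS /= !mulmxBr mulmxDl.
move: (X *m _) (E *m _) (X *m X ^+ j) (X *m _) (E *m _) => a b c d f.
by apply/matrixP => i k; rewrite !mxE; ring.
Qed.

Lemma le1_rad X : 1 <= 1 + m%:R * `|X|.
Proof. by rewrite lerDl mulr_ge0. Qed.

Lemma le_rad X : m%:R * `|X| <= 1 + m%:R * `|X|.
Proof. by rewrite lerDr. Qed.

Lemma rad_ge0 X : 0 <= 2 * (1 + m%:R * `|X|).
Proof. by rewrite mulr_ge0// (le_trans _ (le1_rad X)). Qed.

Lemma geo_expr X : geo_bounded 1 (2 * (1 + m%:R * `|X|)) (fun j => X ^+ j).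
Proof. by apply: geo_bounded_expr; [rewrite (le_trans _ (le1_rad X))|exact: le_rad]. Qed.

Lemma geo_dpow X E :
  geo_bounded (m%:R * `|E|) (2 * (1 + m%:R * `|X|)) (dpow X E).
Proof. exact: geo_bounded_dpow (le1_rad X) (le_rad X) _. Qed.

Lemma expmxE X : expmx X = expseries (fun j => X ^+ j).
Proof. by []. Qed.

Lemma dpow_linear X (a : K) E G j :
  dpow X (a *: E + G) j = a *: dpow X E j + dpow X G j.
Proof.
elim: j => [|j IH] /=; first by rewrite scaler0 addr0.
by rewrite IH mulmxDl mulmxDr -!scalemxAl -!scalemxAr scalerDr addrACA.
Qed.

Lemma dexp_is_linear X : linear (dexp X).
Proof.
move=> a E G; rewrite /dexp.
rewrite (_ : dpow X (a *: E + G) = ( *:%R a \o dpow X E) \+ dpow X G); last first.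
  by apply/funext => j; rewrite dpow_linear.
have H : geo_bounded (`|a| * (m%:R * `|E|)) (2 * (1 + m%:R * `|X|))
    ( *:%R a \o dpow X E).
  by move=> j /=; rewrite normrZ -mulrA ler_wpM2l// geo_dpow.
rewrite (expseriesD (rad_ge0 X) H (rad_ge0 X) (geo_dpow X G)).
by rewrite (expseries_linear ( *:%R a) (rad_ge0 X) (geo_dpow X E)).
Qed.

HB.instance Definition _ X :=
  GRing.isLinear.Build K 'M[K]_m 'M[K]_m _ (dexp X) (dexp_is_linear X).

Lemma expmx_approx (r e : K) X E : 1 <= r ->
    m%:R * `|X| <= r -> m%:R * `|E| <= e -> m%:R * `|X + E| <= r ->
  `|expmx (X + E) - (expmx X + dexp X E)| <= e * e * expR (2 * r).
Proof.
move=> r1 Xr Ee XEr; have r0 : 0 <= 2 * r by rewrite mulr_ge0// (le_trans ler01).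
have Rb := geo_bounded_dexpr2 r1 Xr Ee XEr.
have Xb := geo_bounded_expr (le_trans ler01 r1) Xr.
have Pb := geo_bounded_dpow r1 Xr Ee.
have XPb : geo_bounded (1 + e) (2 * r) ((fun j => X ^+ j) \+ dpow X E).
  by move=> j /=; rewrite (le_trans (ler_normD _ _))// mulrDl lerD.
rewrite [X in X - _](_ : _ = expseries
  (fun j => (X + E) ^+ j - X ^+ j - dpow X E j) + (expmx X + dexp X E)).
  by rewrite addrK; exact: norm_expseries.
rewrite /dexp !expmxE -(expseriesD r0 Xb r0 Pb) -(expseriesD r0 Rb r0 XPb).
by congr expseries; apply/funext => j /=; apply/matrixP => i k; rewrite !mxE; ring.
Qed.

Lemma diff_expmx_subproof X :
  expmx \o shift X = cst (expmx X) + dexp X +o_ 0 id.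
Proof.
apply/eqaddoP => e e0.
(* For [E] of norm at most 1, one radius [r] serves both [X] and [X + E], and [expmx_approx] bounds
   the remainder by [C] times the squared norm of [E]. The divisor below is [C + 1] because [C]
   vanishes for [m = 0]. *)
pose C := m%:R * m%:R * expR (2 * (1 + m%:R * `|X| + m%:R)) : K.
have C0 : 0 <= C by rewrite !mulr_ge0// expR_ge0.
have N1 : \forall E \near (0 : 'M[K]_m), `|E| <= 1 by exact: nbhs0_le.
have N2 : \forall E \near (0 : 'M[K]_m), `|E| <= e / (C + 1).
  by apply: nbhs0_le; rewrite divr_gt0// ltr_wpDl.
near=> E.
rewrite -[_ E]/(expmx (E + X) - (expmx X + dexp X E)) [E + X]addrC.
have E1 : `|E| <= 1 by near: E; exact: N1.
have Ee : `|E| <= e / (C + 1) by near: E; exact: N2.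
have rE : m%:R * `|X + E| <= 1 + m%:R * `|X| + m%:R.
  have -> : 1 + m%:R * `|X| + m%:R = 1 + m%:R * (`|X| + 1) by ring.
  by rewrite ler_wpDl// ler_wpM2l// (le_trans (ler_normD _ _))// lerD2l.
apply: (le_trans (expmx_approx _ _ (lexx _) rE)).
- by rewrite (le_trans (le1_rad X))// lerDl.
- by rewrite (le_trans (le_rad X))// lerDl.
rewrite (_ : _ * _ = (C * `|E|) * `|E|); last by rewrite /C; ring.
rewrite ler_wpM2r//.
apply: (@le_trans _ _ (C * (e / (C + 1)))); first by rewrite ler_wpM2l.
by rewrite mulrCA ler_piMr ?(ltW e0)// ler_pdivrMr ?ltr_wpDl// mul1r lerDl.
Unshelve. all: by end_near. Qed.

Lemma diff_expmx X : 'd (@expmx K m) X = dexp X :> (_ -> _).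
Proof.
apply: diff_unique; last exact: diff_expmx_subproof.
exact: linear_mx_continuous.
Qed.

Lemma differentiable_expmx X : differentiable (@expmx K m) X.
Proof.
apply/diff_locallyP; rewrite diff_expmx; split.
  exact: linear_mx_continuous.
exact: diff_expmx_subproof.
Qed.

Lemma is_derive_expmx X E : is_derive X E (@expmx K m) (dexp X E).
Proof.
apply: DeriveDef; first exact/diff_derivable/differentiable_expmx.
by rewrite deriveE ?diff_expmx//; exact: differentiable_expmx.
Qed.

Lemma LexpE X E : Lexp X E = dexp X E.
Proof. by rewrite /Lexp (@derive_val _ _ _ _ _ _ _ (is_derive_expmx X E)). Qed.

Lemma dpow_rec_r X E j : dpow X E j.+1 = dpow X E j *m X + X ^+ j *m E.
Proof.
elim: j => [|j IH]; first by rewrite /= mulmx0 mul0mx !add0r mulmx1 mul1mx.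
rewrite -[LHS]/(X *m dpow X E j.+1 + E *m X ^+ j.+1) {1}IH /=.
rewrite !mulmxDl !mulmxDr [in LHS]mxexprSr [in RHS]mxexprS !mulmxA -!addrA.
congr (_ + _).
by rewrite addrC.
Qed.

Lemma dpow_mulr X E j : dpow X (E *m X) j = dpow X E j *m X.
Proof.
elim: j => [|j IH] /=; first by rewrite mul0mx.
by rewrite IH mulmxDl -!mulmxA -mxexprS mxexprSr.
Qed.

(** By cyclicity tr (X^a E X^b G) = tr (E X^b G X^a), and both sums run over the same exponents. The
    induction rotates the leading [X] behind [G], hence the generalization over [G]. *)
Lemma mxtrace_dpow X E G j : \tr (dpow X E j *m G) = \tr (E *m dpow X G j).
Proof.
elim: j G => [|j IH] G; first by rewrite /= mul0mx mulmx0.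
rewrite [in RHS]dpow_rec_r /= mulmxDl mulmxDr !mxtraceD -!mulmxA.
by rewrite mxtrace_mulC -mulmxA IH dpow_mulr.
Qed.

Lemma mxtrace_dexp X E G : \tr (dexp X E *m G) = \tr (E *m dexp X G).
Proof.
have cl := cvg_linear_expseries (L := mxtrace \o mulmxr G)
  (rad_ge0 X) (geo_dpow X E).
have cr := cvg_linear_expseries (L := mxtrace \o mulmx E)
  (rad_ge0 X) (geo_dpow X G).
apply: (cvg_unique _ cl) => //.
rewrite (_ : series _ = series (fun j => (j`!%:R)^-1 *
  (mxtrace \o mulmx E) (dpow X G j))) //.
by congr series; apply/funext => j /=; rewrite mxtrace_dpow.
Qed.

(** Under commutation [dpow X E j.+1] consists of [j.+1] equal terms, which turns the weight
    1/(j+1)! into 1/j!. The index shift drops the zero term at index 0. *)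
Lemma dexp_comm X E : X *m E = E *m X -> dexp X E = E *m expmx X.
Proof.
move=> XE; apply: (cvg_unique _ (cvg_expseries (rad_ge0 X) (geo_dpow X E))) => //.
have dE j : dpow X E j.+1 = j.+1%:R *: (E *m X ^+ j).
  elim: j => [|j IH]; first by rewrite /= mulmx0 add0r scale1r.
  rewrite -[LHS]/(X *m dpow X E j.+1 + E *m X ^+ j.+1) IH -scalemxAr mulmxA XE.
  by rewrite -mulmxA -mxexprS -[j.+2%:R]natr1 scalerDl scale1r.
rewrite /= -cvg_shiftS.
rewrite (_ : [sequence _]_n = mulmx E \o
  series (fun j => (j`!%:R)^-1 *: X ^+ j)); last first.
  apply/funext => k /=; rewrite /series/= big_nat_recl//= scaler0 add0r.
  rewrite mulmx_sumr; apply: eq_bigr => j _.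
  rewrite -[X *m _ + _]/(dpow X E j.+1) dE scalerA -scalemxAr; congr (_ *: _).
  by rewrite factS natrM invfM mulrC mulrA divff ?mul1r// pnatr_eq0.
apply: continuous_cvg; last exact: cvg_expseries (rad_ge0 X) (geo_expr X).
exact: linear_mx_continuous.
Qed.

Lemma expmx0 : expmx (0 : 'M[K]_m) = 1%:M.
Proof.
apply: (cvg_unique _ (cvg_expseries (rad_ge0 0) (geo_expr 0))) => //.
rewrite /= -cvg_shiftS.
rewrite (_ : [sequence _]_n = fun=> 1%:M); first exact: cvg_cst.
apply/funext => k /=; rewrite /series/= big_nat_recl//= expr0 fact0 invr1 scale1r.
by rewrite big1 ?addr0// => j _; rewrite mxexprS mul0mx scaler0.
Qed.

Lemma trmx_expmx X : (expmx X)^T = expmx X^T.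
Proof.
rewrite expmxE -[LHS]/((trmx : {linear _ -> _}) _).
rewrite -(expseries_linear _ (rad_ge0 X) (geo_expr X)); congr expseries.
apply/funext => j /=; elim: j => [|j IH]; first by rewrite !expr0 trmx1.
by rewrite mxexprS mxexprSr trmx_mul IH.
Qed.

Lemma is_derive_expmx_scale X (t : K) :
  is_derive t 1 (fun s : K => expmx (s *: X)) (X *m expmx (t *: X)).
Proof.
have XX : t *: X *m X = X *m (t *: X) by rewrite -scalemxAl -scalemxAr.
rewrite -(dexp_comm XX).
have H := @is_derive_affine_comp K K 'M[K]_m 'M[K]_m (fun s => s *: X)
  (@expmx K m) t 1 X (dexp (t *: X) X).
apply: H; last exact: is_derive_expmx.
by move=> h; rewrite scalerDl -scalerA scale1r.
Qed.

Lemma expmx_comm X (t : K) : X *m expmx (t *: X) = expmx (t *: X) *m X.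
Proof.
have := expseries_linear (mulmx X) (rad_ge0 (t *: X)) (geo_expr (t *: X)).
have := expseries_linear (mulmxr X) (rad_ge0 (t *: X)) (geo_expr (t *: X)).
rewrite /= !expmxE => <- <-; congr expseries; apply/funext => j /=.
elim: j => [|j IH]; first by rewrite !expr0 mulmx1 mul1mx.
rewrite mxexprS mulmxA -[RHS]mulmxA -IH mulmxA; congr (_ *m _).
by rewrite -scalemxAl -scalemxAr.
Qed.

Lemma is_derive_expmx_scaler X (t : K) :
  is_derive t 1 (fun s : K => expmx (s *: X)) (expmx (t *: X) *m X).
Proof. by rewrite -expmx_comm; exact: is_derive_expmx_scale. Qed.

Lemma expmxNr X (t : K) : expmx (t *: X) *m expmx (- (t *: X)) = 1%:M.
Proof.
rewrite -scalerN.
pose f (s : K) := expmx (s *: X) *m expmx (s *: - X).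
rewrite -[LHS]/(f t) (_ : f t = f 0).
  by rewrite /f !scale0r expmx0 mulmx1.
apply: is_derive0_mx_cst => s.
apply: is_derive_eq; first exact: is_derive_mulmx
  (is_derive_expmx_scaler X s) (is_derive_expmx_scale (- X) s).
by rewrite mulNmx mulmxN mulmxA subrr.
Qed.

Lemma expmx_orthogonal X (t : K) : antisym X ->
  (expmx (t *: X))^T *m expmx (t *: X) = 1%:M.
Proof.
move=> XA; rewrite trmx_expmx linearZ/= XA.
by have := expmxNr X (- t); rewrite !scaleNr opprK scalerN.
Qed.

End Dexp.

(** The product of [X s] with [expmx (s *: - M)] has derivative zero; this stands in for a general
    uniqueness theorem on differential equations. *)
Lemma linear_ode (K : realType) (q r : nat) (X : K -> 'M[K]_(q, r))
    (M : 'M[K]_r) (t : K) :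
  (forall s : K, is_derive s 1 X (X s *m M)) -> X t = X 0 *m expmx (t *: M).
Proof.
move=> XM; pose f (s : K) := X s *m expmx (s *: - M).
have f0 : f t = f 0.
  apply: is_derive0_mx_cst => s.
  apply: is_derive_eq; first exact: is_derive_mulmx
    (XM s) (is_derive_expmx_scale (- M) s).
  by rewrite mulNmx mulmxN mulmxA subrr.
have := f0; rewrite /f scale0r expmx0 mulmx1 => <-.
rewrite -[LHS]mulmx1 -mulmxA scalerN; congr (_ *m _).
by have := expmxNr M (- t); rewrite !scaleNr opprK.
Qed.

(** * The Levi-Civita connection of the Stiefel manifold *)

Section LeviCivita.
Context {K : realType} {n p : nat}.
Variables (alpha0 alpha1 : K).
Implicit Types (X V W : 'M[K]_(n, p) -> 'M[K]_(n, p)).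
Implicit Types (Y x v w : 'M[K]_(n, p)).
Local Notation metric := (metric alpha0 alpha1).

Lemma tangent_trmx Y x : tangent Y x -> x^T *m Y = - (Y^T *m x).
Proof. by rewrite /tangent /antisym trmx_mul trmxK. Qed.

(** A [tangent_field] is tangent at points of the manifold only, so its tangency can be
    differentiated only along curves that stay there. *)
Lemma stiefel_curve Y x : stiefel Y -> tangent Y x ->
  exists c : K -> 'M[K]_(n, p),
    [/\ forall t, stiefel (c t), c 0 = Y & is_derive (0 : K) 1 c x].
Proof.
(* [S] is an antisymmetric solution of S Y = x: its first two terms send [Y] to x + Y Y^T x, and the
   third removes the excess. Its exponentials are orthogonal, so they keep [Y] on the manifold. *)
move=> YY xT; set S := x *m Y^T - Y *m x^T - Y *m (Y^T *m x) *m Y^T.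
have SA : antisym S.
  rewrite /antisym /S !trmxB !trmx_mul !trmxK (tangent_trmx xT).
  rewrite mulNmx mulmxN !mulmxA; move: (x *m _) (Y *m x^T) (_ *m Y^T) => a b c.
  by apply/matrixP => i j; rewrite !mxE; ring.
have SY : S *m Y = x.
  rewrite /S !mulmxBl -!mulmxA YY mulmx1 (tangent_trmx xT) mulmxN opprK.
  by rewrite addrK.
exists (fun t => expmx (t *: S) *m Y); split => [t||].
- rewrite /stiefel trmx_mul mulmxA -[_ *m _ *m expmx _]mulmxA.
  by rewrite expmx_orthogonal// mulmx1.
- by rewrite scale0r expmx0 mul1mx.
- have := is_derive_mulmxr Y (is_derive_expmx_scale S 0).
  by rewrite scale0r expmx0 mulmx1 SY.
Qed.

Lemma tangent_field_diff V Y x :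
    tangent_field V -> stiefel Y -> tangent Y x ->
  antisym (x^T *m V Y + Y^T *m 'd V Y x).
Proof.
move=> VT YY xT; have [c [cS c0 cd]] := stiefel_curve YY xT.
have Vd : differentiable V (c 0) by rewrite c0; have [] := VT Y YY.
have := is_derive_mulmx (is_derive_trmx cd) (is_derive_comp_diff cd Vd).
rewrite c0 => fd; apply: (is_derive_unique (is_derive_trmx fd)).
rewrite (_ : (fun t => _) = - (fun t => (c t)^T *m V (c t))); last first.
  by apply/funext => t; have [_] := VT _ (cS t).
exact: is_deriveN.
Qed.

(** The Euclidean orthogonal projection of the constant [x] onto the tangent space at [Y]. It is
    polynomial in [Y], hence differentiable, and turns a tangent vector into a field to which the
    axioms of [levi_civita] apply. *)
Definition tangent_ext x : 'M[K]_(n, p) -> 'M[K]_(n, p) :=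
  fun Y => x - 2^-1 *: (Y *m (Y^T *m x + x^T *m Y)).

Lemma tangent_ext_field x : tangent_field (tangent_ext x).
Proof.
move=> Y YY; split.
  apply: differentiableB; first exact: differentiable_cst.
  apply: (differentiableZ (f := fun Z => Z *m (Z^T *m x + x^T *m Z))).
  have Yd : differentiable (fun Z : 'M[K]_(n, p) => Z) Y by [].
  apply: (differentiable_mulmx Yd).
  have Ytd : differentiable (fun Z : 'M[K]_(n, p) => Z^T) Y.
    exact: (@differentiable_trmx _ _ _ _ id).
  apply: differentiableD.
    exact: (differentiable_mulmx Ytd (differentiable_cst x Y)).
  exact: (differentiable_mulmx (differentiable_cst x^T Y) Yd).
rewrite /tangent /antisym /tangent_ext mulmxBr -scalemxAr mulmxA YY mul1mx.
rewrite linearB linearZ linearD/= !trmx_mul !trmxK.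
move: (Y^T *m x) (x^T *m Y) => a b.
by apply/matrixP => i j; rewrite !mxE; lra.
Qed.

Lemma tangent_ext_id Y x : tangent Y x -> tangent_ext x Y = x.
Proof.
by move=> xT; rewrite /tangent_ext (tangent_trmx xT) subrr mulmx0 scaler0 subr0.
Qed.

Lemma metricE Y v w : metric Y v w =
  alpha0 * \tr (v^T *m w) + (alpha1 - alpha0) * \tr ((Y^T *m v)^T *m (Y^T *m w)).
Proof.
by rewrite /metric mulmxDr -!scalemxAr mxtraceD !mxtraceZ trmx_mul trmxK !mulmxA.
Qed.

Lemma metric_sym Y v w : metric Y v w = metric Y w v.
Proof.
rewrite !metricE -[in LHS](mxtrace_tr (v^T *m w)).
by rewrite -[in LHS](mxtrace_tr (_^T *m (Y^T *m w))) !trmx_mul !trmxK.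
Qed.

Lemma metricDl Y v1 v2 w : metric Y (v1 + v2) w = metric Y v1 w + metric Y v2 w.
Proof. by rewrite !metricE !mulmxDr !linearD/= !mulmxDl !mxtraceD; ring. Qed.

Lemma metricBl Y v1 v2 w : metric Y (v1 - v2) w = metric Y v1 w - metric Y v2 w.
Proof.
by apply/eqP; rewrite eq_sym subr_eq -metricDl subrK.
Qed.

Lemma metricDr Y v w1 w2 : metric Y v (w1 + w2) = metric Y v w1 + metric Y v w2.
Proof. by rewrite metric_sym metricDl ![metric _ _ v]metric_sym. Qed.

(** Splitting [v] into [N], orthogonal to the columns of [Y], and Y (Y^T v) diagonalizes the metric,
    with weights [alpha0] and [alpha1]. *)
Lemma metric_def Y v : 0 < alpha0 -> 0 < alpha1 -> stiefel Y ->
  metric Y v v = 0 -> v = 0.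
Proof.
move=> a0 a1 YY.
set N := v - Y *m (Y^T *m v).
have -> : metric Y v v =
    alpha0 * \tr (N^T *m N) + alpha1 * \tr ((Y^T *m v)^T *m (Y^T *m v)).
  have -> : N^T *m N = v^T *m v - (Y^T *m v)^T *m (Y^T *m v).
    rewrite /N; set M := Y^T *m v.
    have vY : v^T *m Y = M^T by rewrite trmx_mul trmxK.
    rewrite [(v - _)^T]linearB/= [(Y *m M)^T]trmx_mul !mulmxBl !mulmxBr -!mulmxA.
    by rewrite [Y^T *m (Y *m M)]mulmxA YY mul1mx -/M subrr subr0 mulmxA vY.
  by rewrite metricE raddfB/=; ring.
move=> /eqP; rewrite paddr_eq0 ?mulr_ge0 ?mxtrace_normsq_ge0 ?(ltW a0) ?(ltW a1)//.
rewrite !mulf_eq0 (gt_eqF a0) (gt_eqF a1)/= => /andP[/eqP/mxtrace_normsq_eq0 N0].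
move=> /eqP/mxtrace_normsq_eq0 v0.
by move: N0; rewrite /N v0 mulmx0 subr0.
Qed.

(** The first summand is the normal correction of the embedded manifold, and all of the function in
    the Euclidean case alpha = 1. The second is tangent and accounts for the different weight on the
    part Y Y^T. *)
Definition christoffel Y x v : 'M[K]_(n, p) :=
  2^-1 *: (Y *m (x^T *m v + v^T *m x)) +
  (1 - alpha1 / alpha0) *:
    ((1%:M - Y *m Y^T) *m (x *m v^T + v *m x^T) *m Y).

Lemma christoffel_sym Y x v : christoffel Y x v = christoffel Y v x.
Proof. by rewrite /christoffel [x^T *m v + _]addrC [x *m _ + _]addrC. Qed.

Lemma christoffel_linearl Y (c : K) x1 x2 v :
  christoffel Y (c *: x1 + x2) v = c *: christoffel Y x1 v + christoffel Y x2 v.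
Proof.
have E0 : (c *: x1 + x2)^T = c *: x1^T + x2^T by rewrite linearP.
have E1 : (c *: x1^T + x2^T) *m v + v^T *m (c *: x1 + x2) =
          c *: (x1^T *m v + v^T *m x1) + (x2^T *m v + v^T *m x2).
  by rewrite mulmxDl mulmxDr -scalemxAl -scalemxAr scalerDr addrACA.
have E2 : (c *: x1 + x2) *m v^T + v *m (c *: x1^T + x2^T) =
          c *: (x1 *m v^T + v *m x1^T) + (x2 *m v^T + v *m x2^T).
  by rewrite mulmxDl mulmxDr -scalemxAl -scalemxAr scalerDr addrACA.
rewrite /christoffel E0 E1 E2; move: (x1^T *m v + _) (x2^T *m v + _) => a b.
move: (x1 *m _ + _) (x2 *m _ + _) => d e.
rewrite !mulmxDr -!scalemxAr [(_ + _) *m Y]mulmxDl -scalemxAl.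
by apply/matrixP => i j; rewrite !mxE; ring.
Qed.

Lemma mul_trmx_christoffel Y x v : stiefel Y ->
  Y^T *m christoffel Y x v = 2^-1 *: (x^T *m v + v^T *m x).
Proof.
move=> YY; rewrite /christoffel [Y^T *m _]mulmxDr -!scalemxAr !mulmxA YY mul1mx.
by rewrite mulmxBr mulmx1 mulmxA YY mul1mx subrr !mul0mx scaler0 addr0.
Qed.

(** The first summand of [christoffel] contributes nothing: it yields a symmetric matrix traced
    against the antisymmetric Y^T w. The factor is alpha0 (1 - alpha). *)
Lemma metric_christoffel Y x v w : alpha0 != 0 -> stiefel Y ->
    tangent Y x -> tangent Y v -> tangent Y w ->
  metric Y (christoffel Y x v) w = (alpha0 - alpha1) *
    (\tr (Y^T *m x *m (v^T *m w)) + \tr (Y^T *m x *m (Y^T *m v *m (Y^T *m w)))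
   + \tr (Y^T *m v *m (x^T *m w)) + \tr (Y^T *m v *m (Y^T *m x *m (Y^T *m w)))).
Proof.
move=> a0 YY xT vT wT; rewrite metricE mul_trmx_christoffel//.
have sS : (x^T *m v + v^T *m x)^T = x^T *m v + v^T *m x.
  by rewrite linearD/= !trmx_mul !trmxK addrC.
rewrite linearZ/= sS -scalemxAl mxtraceZ (mxtrace_sym_antisym sS wT) !mulr0 addr0.
have pw u : u^T *m ((1%:M - Y *m Y^T) *m w) =
            u^T *m w + - (u^T *m Y) *m (Y^T *m w).
  by rewrite mulmxBl mul1mx mulmxBr mulNmx !mulmxA.
have -> : (christoffel Y x v)^T *m w =
    2^-1 *: ((x^T *m v + v^T *m x) *m (Y^T *m w)) +
    (1 - alpha1 / alpha0) *: (Y^T *m x *m (v^T *m ((1%:M - Y *m Y^T) *m w)) +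
                              Y^T *m v *m (x^T *m ((1%:M - Y *m Y^T) *m w))).
  have -> : (christoffel Y x v)^T =
      2^-1 *: ((x^T *m v + v^T *m x) *m Y^T) + (1 - alpha1 / alpha0) *:
        (Y^T *m (x *m v^T + v *m x^T) *m (1%:M - Y *m Y^T)).
    rewrite linearD !linearZ/=; congr (_ *: _ + _ *: _); first by rewrite trmx_mul sS.
    have s1 : (1%:M - Y *m Y^T)^T = 1%:M - Y *m Y^T.
      by rewrite linearB/= trmx1 trmx_mul trmxK.
    have s2 : (x *m v^T + v *m x^T)^T = x *m v^T + v *m x^T.
      by rewrite linearD/= !trmx_mul !trmxK addrC.
    by rewrite trmx_mul [(_ *m (_ + _))^T]trmx_mul s1 s2 mulmxA.
  rewrite [LHS]mulmxDl -!scalemxAl; congr (_ *: _ + _ *: _); first by rewrite mulmxA.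
  by rewrite -[LHS]mulmxA [Y^T *m (_ + _)]mulmxDr [LHS]mulmxDl !mulmxA.
rewrite mxtraceD !mxtraceZ (mxtrace_sym_antisym sS wT) mulr0 add0r.
rewrite !pw (tangent_trmx xT) (tangent_trmx vT) !opprK !mulmxDr !mxtraceD.
by field.
Qed.

(** The last two traces come from differentiating the factor Y Y^T inside the metric. *)
Lemma diff_metric V W Y x :
    differentiable V Y -> differentiable W Y ->
  'd (fun Y' => metric Y' (V Y') (W Y')) Y x =
  metric Y ('d V Y x) (W Y) + metric Y (V Y) ('d W Y x) +
  (alpha1 - alpha0) *
    (\tr ((V Y)^T *m x *m (Y^T *m W Y)) + \tr ((V Y)^T *m Y *m (x^T *m W Y))).
Proof.
move=> Vd Wd.
have Ytd : differentiable (fun Z : 'M[K]_(n, p) => Z^T) Y.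
  exact: (@differentiable_trmx _ _ _ _ id).
pose P Z := alpha0 *: W Z + (alpha1 - alpha0) *: (Z *m Z^T *m W Z).
have Pd : differentiable P Y.
  apply: differentiableD; apply: differentiableZ => //.
  by apply: differentiable_mulmx => //; apply: differentiable_mulmx.
have md : differentiable (fun Z => metric Z (V Z) (W Z)) Y.
  apply: differentiable_mxtrace; apply: differentiable_mulmx => //.
  exact: differentiable_trmx.
have WD : is_derive Y x W ('d W Y x) by exact: is_derive_diff.
have VD : is_derive Y x V ('d V Y x) by exact: is_derive_diff.
have ID : is_derive Y x (fun Z : 'M[K]_(n, p) => Z) x by exact: is_derive_id.
have PD : is_derive Y x P (alpha0 *: 'd W Y x + (alpha1 - alpha0) *:
    ((x *m Y^T + Y *m x^T) *m W Y + Y *m Y^T *m 'd W Y x)).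
  apply: is_deriveD; apply: is_deriveZ.
  apply: is_derive_mulmx => //.
  exact: is_derive_mulmx ID (is_derive_trmx ID).
have := is_derive_mxtrace (is_derive_mulmx (is_derive_trmx VD) PD).
move=> /(is_derive_unique (is_derive_diff x md)) ->.
rewrite /P !metricE.
rewrite !mulmxDr -!scalemxAr !mulmxDl !mulmxDr !mxtraceD !mxtraceZ !mxtraceD.
by rewrite !trmx_mul !trmxK !mulmxA; ring.
Qed.

Lemma levi_civita_christoffel : 0 < alpha0 ->
  levi_civita alpha0 alpha1 christoffel.
Proof.
move=> a0; split.
- by move=> Y c w1 w2 eta _ _ _ _; exact: christoffel_linearl.
- move=> Y c w eta1 eta2 _ _ _ _; rewrite !(christoffel_sym _ w).
  exact: christoffel_linearl.
(* Differentiated tangency says that the symmetric part of Y^T dV(X) is minus that of X^T V, which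
   the first summand of [christoffel] compensates. *)
- move=> X V XT VT Y YY; have := tangent_field_diff VT YY (XT Y YY).2.
  rewrite /tangent /covariant mulmxDr mul_trmx_christoffel//.
  have -> : (V Y)^T *m X Y = ((X Y)^T *m V Y)^T by rewrite trmx_mul trmxK.
  move: (_ *m V Y) (Y^T *m _) => a d /matrixP E.
  by apply/matrixP => i j; have := E i j; rewrite !mxE; lra.
- move=> X V XT VT Y YY; rewrite /covariant christoffel_sym.
  by rewrite opprD addrACA subrr addr0.
- move=> X V W XT VT WT Y YY.
  have [[_ xT] [Vd vT] [Wd wT]] := And3 (XT Y YY) (VT Y YY) (WT Y YY).
  have a0' : alpha0 != 0 by rewrite gt_eqF.
  rewrite diff_metric// /covariant metricDl metricDr.
  rewrite [metric Y (V Y) (christoffel _ _ _)]metric_sym.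
  rewrite !metric_christoffel//.
  (* By transposition six of the eight Christoffel traces cancel in pairs. The other two are minus
     those from the derivative of Y Y^T, whose coefficient is the opposite one. *)
  have E1 : \tr (Y^T *m X Y *m ((W Y)^T *m V Y)) =
      - \tr (Y^T *m X Y *m ((V Y)^T *m W Y)).
    rewrite -[LHS]mxtrace_tr trmx_mul [((W Y)^T *m _)^T]trmx_mul trmxK xT.
    by rewrite mulmxN mxtraceN mxtrace_mulC.
  have tr3 (a b c : 'M[K]_p) : antisym a -> antisym b -> antisym c ->
      \tr (a *m (b *m c)) = - \tr (a *m (c *m b)).
    move=> aA bA cA; rewrite -[LHS]mxtrace_tr !trmx_mul aA bA cA.
    by rewrite !(mulmxN, mulNmx, opprK) mxtraceN mxtrace_mulC.
  rewrite E1 (tr3 (Y^T *m X Y) (Y^T *m W Y))//.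
  have -> : \tr (Y^T *m W Y *m (Y^T *m X Y *m (Y^T *m V Y))) =
      - \tr (Y^T *m V Y *m (Y^T *m X Y *m (Y^T *m W Y))).
    by rewrite tr3// mxtrace_mulC -(mulmxA (Y^T *m V Y)).
  rewrite (tangent_trmx vT) mulNmx mxtraceN.
  have -> : \tr ((V Y)^T *m X Y *m (Y^T *m W Y)) =
      - \tr (Y^T *m W Y *m ((X Y)^T *m V Y)).
    rewrite -[LHS]mxtrace_tr trmx_mul [((V Y)^T *m _)^T]trmx_mul trmxK wT.
    by rewrite mulNmx mxtraceN.
  move: (metric Y _ _) (metric Y _ _) (\tr (_ *m W Y *m _)) => m1 m2 t1.
  move: (\tr (_ *m V Y *m (_ *m W Y))) (\tr (_ *m X Y *m (_ *m W Y))) => t2 t3.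
  move: (\tr (_ *m X Y *m _)) (\tr (_ *m V Y *m _)) => t4 t5.
  ring.
Qed.

Local Opaque Defs.metric.

(** Torsion-freeness concerns fields; on the extensions of [x] and [v] the derivative terms cancel
    and only values of [Gamma] at [Y] remain. *)
Lemma levi_civita_sym Gamma Y x v : levi_civita alpha0 alpha1 Gamma ->
  stiefel Y -> tangent Y x -> tangent Y v -> Gamma Y x v = Gamma Y v x.
Proof.
move=> LC YY xT vT.
have := lc_torsion_free LC (tangent_ext_field x) (tangent_ext_field v) YY.
rewrite /covariant !tangent_ext_id// opprD addrACA -[RHS]addr0 => /addrI /eqP.
by rewrite subr_eq0 => /eqP.
Qed.

(* The difference of two Levi-Civita connections, paired with a third tangent
   vector, is symmetric in the first two arguments and alternating in the last
   two, hence zero. *)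
Lemma levi_civita_unique Gamma1 Gamma2 Y x : 0 < alpha0 -> 0 < alpha1 ->
    levi_civita alpha0 alpha1 Gamma1 -> levi_civita alpha0 alpha1 Gamma2 ->
    stiefel Y -> tangent Y x ->
  Gamma1 Y x x = Gamma2 Y x x.
Proof.
move=> a0 a1 LC1 LC2 YY.
pose S u v w := metric Y (Gamma1 Y u v - Gamma2 Y u v) w.
have Ssym u v w : tangent Y u -> tangent Y v -> S u v w = S v u w.
  move=> uT vT; rewrite /S (levi_civita_sym LC1 YY uT vT).
  by rewrite (levi_civita_sym LC2 YY uT vT).
have Santi u v w : tangent Y u -> tangent Y v -> tangent Y w ->
    S u v w = - S u w v.
  move=> uT vT wT; rewrite /S !metricBl.
  have := lc_metric LC1 (tangent_ext_field u) (tangent_ext_field v)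
    (tangent_ext_field w) YY.
  rewrite (lc_metric LC2 (tangent_ext_field u) (tangent_ext_field v)
    (tangent_ext_field w) YY) /covariant.
  rewrite (tangent_ext_id uT) (tangent_ext_id vT) (tangent_ext_id wT).
  rewrite !metricDl !metricDr ![metric Y v (_ Y u w)]metric_sym.
  move: (metric _ ('d _ _ _) _) (metric _ _ ('d _ _ _)) => t1 t2.
  move: (metric _ (Gamma1 Y u v) _) (metric _ (Gamma2 Y u v) _) => t3 t4.
  move: (metric _ (Gamma1 Y u w) _) (metric _ (Gamma2 Y u w) _) => t5 t6.
  by move=> E; lra.
move=> xT.
(* The two Christoffel values need not be tangent, but adding the same derivative makes both so;
   hence their difference is tangent and can be paired with itself. *)
have DT : tangent Y (Gamma1 Y x x - Gamma2 Y x x).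
  have := lc_tangent LC1 (tangent_ext_field x) (tangent_ext_field x) YY.
  have := lc_tangent LC2 (tangent_ext_field x) (tangent_ext_field x) YY.
  rewrite /tangent /antisym /covariant !(tangent_ext_id xT).
  rewrite [Y^T *m (_ - _)]mulmxBr !(mulmxDr Y^T).
  move: (Y^T *m _) (Y^T *m _) (Y^T *m _) => a b c /matrixP E2 /matrixP E1.
  apply/matrixP => i j; have := E1 i j; have := E2 i j.
  by rewrite !mxE; lra.
have S0 w : tangent Y w -> S x x w = 0.
  move=> wT; have := Santi _ _ _ wT xT xT; have := Santi _ _ _ xT xT wT.
  rewrite (Ssym w x x wT xT); move: (S _ _ _) (S _ _ _) => t1 t2; lra.
apply/eqP; rewrite -subr_eq0; apply/eqP; apply: (metric_def a0 a1 YY).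
exact: S0 DT.
Qed.

End LeviCivita.

(** * Geodesics *)

Section Geodesics.
Context {K : realType} {n p : nat}.
Variables (alpha0 alpha1 : K).
Hypotheses (a0 : 0 < alpha0) (a1 : 0 < alpha1).
Local Notation alpha := (alpha1 / alpha0).
Local Notation beta := (1 - 2 * alpha).
Local Notation Gamma := (christoffel alpha0 alpha1).
Implicit Types c : K -> 'M[K]_(n, p).

Lemma christoffel_diag (Y x : 'M[K]_(n, p)) : Gamma Y x x =
  Y *m (x^T *m x) +
  (2 * (1 - alpha)) *: ((1%:M - Y *m Y^T) *m (x *m (x^T *m Y))).
Proof.
rewrite /christoffel (mxD2 (x^T *m x)) (mxD2 (x *m x^T)).
rewrite -!scalemxAr -scalemxAl !scalerA mulVf ?pnatr_eq0// scale1r !mulmxA.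
by rewrite [_ * 2]mulrC.
Qed.

Lemma stiefel_velocity c (t : K) d : (forall s, stiefel (c s)) ->
  is_derive t 1 c d -> tangent (c t) d.
Proof.
move=> cS cd; have := is_derive_mulmx (is_derive_trmx cd) cd.
rewrite (_ : (fun s => _) = cst 1%:M); last by apply/funext => s; exact: cS.
move=> /(is_derive_unique (is_derive_cst _ _ _)) E.
rewrite /tangent /antisym trmx_mul trmxK; apply/eqP.
by rewrite -addr_eq0 -E.
Qed.

(** The geodesic comes with an unknown [Gamma]; uniqueness on the diagonal replaces it by
    [christoffel]. *)
Lemma geodesic_ode c (t : K) : is_geodesic alpha0 alpha1 c ->
  is_derive t 1 (c^`()%classic) (- Gamma (c t) (c^`()%classic t) (c^`()%classic t)).
Proof.
move=> [cS cd [G GL cG]].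
have cT : tangent (c t) (c^`()%classic t).
  exact: stiefel_velocity cS (is_derive_derive1 (cd t).1).
rewrite -(levi_civita_unique a0 a1 GL (levi_civita_christoffel alpha1 a0) (cS t) cT).
have -> : - G (c t) (c^`()%classic t) (c^`()%classic t) = (c^`()^`())%classic t.
  by apply/esym/eqP; rewrite -addr_eq0 cG.
exact: is_derive_derive1 (cd t).2.
Qed.

(** * Reduction of the geodesic equation to a linear one *)

Section LinearForm.
Variables (c : K -> 'M[K]_(n, p)) (A : 'M[K]_p).
Hypothesis cgeo : is_geodesic alpha0 alpha1 c.
Hypothesis cA : (c 0)^T *m (c^`()%classic 0) = A.
Local Notation c' := (c^`()%classic).

Let cS t : stiefel (c t). Proof. by case: cgeo. Qed.
Let cd t : is_derive (t : K) 1 c (c' t).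
Proof. by case: cgeo => _ /(_ t)[] /is_derive_derive1. Qed.

(** The derivative is c'^T c' - c^T Gamma(c', c'), and the normal summand of the Christoffel
    function makes the two terms equal. *)
Lemma geodesic_momentum t : (c t)^T *m c' t = A.
Proof.
rewrite -cA; apply: (@is_derive0_mx_cst _ _ _ (fun t => (c t)^T *m c' t)) => s.
apply: is_derive_eq.
  exact: is_derive_mulmx (is_derive_trmx (cd s)) (geodesic_ode s cgeo).
rewrite mulmxN mul_trmx_christoffel; last exact: cS.
rewrite (mxD2 (_^T *m _)) scalerA.
by rewrite mulVf ?pnatr_eq0// scale1r subrr.
Qed.

Let AA : antisym A.
Proof. by rewrite -(geodesic_momentum 0); exact: stiefel_velocity cS (cd 0). Qed.

Let c'c t : (c' t)^T *m c t = - A.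
Proof.
rewrite -(geodesic_momentum t); apply: tangent_trmx.
exact: stiefel_velocity cS (cd t).
Qed.

Definition normal_part t := c' t - c t *m A.
Local Notation h := normal_part.

Let ch t : (c t)^T *m h t = 0.
Proof. by rewrite mulmxBr geodesic_momentum mulmxA cS mul1mx subrr. Qed.

Let hc t : (h t)^T *m c t = 0.
Proof. by rewrite -[LHS]trmxK trmx_mul trmxK ch trmx0. Qed.

Let c'E t : c' t = h t + c t *m A. Proof. by rewrite subrK. Qed.

(** [beta] arises as 2 (1 - alpha), from the Christoffel function, minus 1, from differentiating c
    A; the terms in A A cancel. *)
Let is_derive_normal_part t : is_derive (t : K) 1 h
  (beta *: (h t *m A) - c t *m ((h t)^T *m h t)).
Proof.
apply: is_derive_eq.
  exact: is_deriveB (geodesic_ode t cgeo) (is_derive_mulmxr A (cd t)).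
have c'c' : (c' t)^T *m c' t = (h t)^T *m h t - A *m A.
  have E1 : (h t)^T *m (c t *m A) = 0 by rewrite mulmxA hc mul0mx.
  have E2 : (c t *m A)^T *m h t = 0 by rewrite trmx_mul -mulmxA ch mulmx0.
  have E3 : (c t *m A)^T *m (c t *m A) = - (A *m A).
    by rewrite trmx_mul -mulmxA [(c t)^T *m _]mulmxA cS mul1mx AA mulNmx.
  rewrite [in LHS](c'E t); move: (h t) (c t *m A) E1 E2 E3 => x y E1 E2 E3.
  by rewrite trmxD mulmxDl !mulmxDr E1 E2 E3 addr0 add0r.
have P1 : (1%:M - c t *m (c t)^T) *m (c' t *m - A) = - (h t *m A).
  rewrite mulmxBl mul1mx -mulmxA [(c t)^T *m _]mulmxA geodesic_momentum.
  by rewrite !mulmxN -opprD mulmxA -mulmxBl.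
have P2 : c' t *m A = h t *m A + c t *m (A *m A).
  by rewrite {1}(c'E t) mulmxDl mulmxA.
rewrite christoffel_diag c'c' c'c P1 P2 mulmxBr.
move: (h t *m A) (c t *m (_ *m h t)) (c t *m (A *m A)) => x y z.
by apply/matrixP => i j; rewrite !mxE; ring.
Qed.

Local Notation e t := (expmx (t *: (- (beta *: A)))).

Let eA (t : K) : (e t)^T *m e t = 1%:M.
Proof.
by apply: expmx_orthogonal; rewrite /antisym trmxN trmxZ AA scalerN.
Qed.

Let Ae (t : K) : A *m e t = e t *m A.
Proof.
rewrite (_ : t *: - (beta *: A) = (- (t * beta)) *: A) ?expmx_comm//.
by rewrite scalerN scalerA scaleNr.
Qed.

Let is_derive_e (t : K) : is_derive t 1 (fun s => e s) (- (beta *: (e t *m A))).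
Proof.
apply: is_derive_eq; first exact: is_derive_expmx_scale.
by rewrite mulNmx -scalemxAl Ae.
Qed.

(* In the frame rotated by [e], the position [V] and the normal part [H] of the
   velocity satisfy V' = H + 2 alpha V A and H' = - V (H^T H), where H^T H is
   conserved: the geodesic equation becomes linear with constant coefficients. *)
Lemma geodesic_linear s : c s =
  lsubmx (row_mx (c 0) (h 0) *m
    expmx (s *: block_mx ((2 * alpha) *: A) (- ((h 0)^T *m h 0)) 1%:M 0)) *m
  (e s)^T.
Proof.
pose V t := c t *m e t; pose H t := h t *m e t.
have Vd t : is_derive (t : K) 1 V (H t + (2 * alpha) *: (V t *m A)).
  apply: is_derive_eq; first exact: is_derive_mulmx (cd t) (is_derive_e t).
  have -> : c' t *m e t = h t *m e t + c t *m (e t *m A).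
    by rewrite {1}(c'E t) mulmxDl -mulmxA Ae.
  rewrite mulmxN -scalemxAr /V /H -[c t *m e t *m A]mulmxA.
  move: (h t *m _) (c t *m _) => x y.
  by apply/matrixP => i j; rewrite !mxE; ring.
have Hd t : is_derive (t : K) 1 H (- (V t *m ((H t)^T *m H t))).
  apply: is_derive_eq.
    exact: is_derive_mulmx (is_derive_normal_part t) (is_derive_e t).
  have -> : V t *m ((H t)^T *m H t) = c t *m ((h t)^T *m h t) *m e t.
    rewrite /V /H trmx_mul !mulmxA -[c t *m e t *m (e t)^T]mulmxA.
    by rewrite (mulmx1C (eA t)) mulmx1.
  rewrite mulmxBl -scalemxAl -[h t *m A *m _]mulmxA Ae mulmxN -scalemxAr.
  move: (h t *m _) (c t *m _ *m _) => x y.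
  by apply/matrixP => i j; rewrite !mxE; ring.
have HV t : (H t)^T *m V t = 0.
  by rewrite /V /H trmx_mul !mulmxA -[_ *m _ *m c t]mulmxA hc mulmx0 mul0mx.
have VH t : (V t)^T *m H t = 0.
  by rewrite -[LHS]trmxK trmx_mul trmxK HV trmx0.
have e0 : e 0 = 1%:M by rewrite scale0r expmx0.
have H0 : H 0 = h 0 by rewrite /H e0 mulmx1.
have V0 : V 0 = c 0 by rewrite /V e0 mulmx1.
have cV t : c t = V t *m (e t)^T.
  by rewrite /V -mulmxA (mulmx1C (eA t)) mulmx1.
clearbody V H.
have HH t : (H t)^T *m H t = (H 0)^T *m H 0.
  apply: (@is_derive0_mx_cst _ _ _ (fun u => (H u)^T *m H u)) => u.
  apply: is_derive_eq.
    exact: is_derive_mulmx (is_derive_trmx (Hd u)) (Hd u).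
  rewrite trmxN [(V u *m _)^T]trmx_mul mulNmx -[_ *m _ *m H u]mulmxA VH mulmx0.
  by rewrite mulmxN [(H u)^T *m (V u *m _)]mulmxA HV mul0mx oppr0 addr0.
rewrite cV -H0 -V0; set M := block_mx _ _ _ _.
have <- : row_mx (V s) (H s) = row_mx (V 0) (H 0) *m expmx (s *: M).
  apply: (@linear_ode _ _ _ (fun t => row_mx (V t) (H t))) => t.
  rewrite mul_row_block mulmx0 addr0 mulmx1 mulmxN -scalemxAr -(HH t) addrC.
  exact: is_derive_row_mx.
by rewrite row_mxKl.
Qed.

End LinearForm.

Lemma geodesic_unique c1 c2 :
    is_geodesic alpha0 alpha1 c1 -> is_geodesic alpha0 alpha1 c2 ->
    c1 0 = c2 0 -> c1^`()%classic 0 = c2^`()%classic 0 ->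
  c1 = c2.
Proof.
move=> g1 g2 E0 E1; apply/funext => t.
rewrite (geodesic_linear g1 erefl) (geodesic_linear g2 erefl) /normal_part.
by rewrite E0 E1.
Qed.

End Geodesics.

(** * The explicit curve is the geodesic *)

Section ExplicitGeodesic.
Context {K : realType} {n p k : nat}.
Variables (alpha0 alpha1 : K).
Hypotheses (a0 : 0 < alpha0) (a1 : 0 < alpha1).
Local Notation alpha := (alpha1 / alpha0).
Local Notation beta := (1 - 2 * alpha).
Variables (Yt : 'M[K]_(n, p)) (Q : 'M[K]_(n, k)).
Hypotheses (YY : stiefel Yt) (QQ : Q^T *m Q = 1%:M) (YQ : Yt^T *m Q = 0).
Variables (A : 'M[K]_p) (R : 'M[K]_(k, p)).
Hypothesis AA : antisym A.

Local Notation Ahat := (block_mx ((2 * alpha) *: A) (- R^T) R 0).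
Local Notation Ipk := (@col_mx K p k p 1%:M 0).
Local Notation C := (col_mx A R).
Local Notation U t := (row_mx Yt Q *m expmx (t *: Ahat)).
Local Notation W t := (expmx (t *: (beta *: A))).

Definition stiefel_geodesic (t : K) : 'M[K]_(n, p) := U t *m Ipk *m W t.
Local Notation c := stiefel_geodesic.

Let Ahat_antisym : antisym Ahat.
Proof.
rewrite /antisym tr_block_mx opp_block_mx trmxZ AA trmxN trmxK trmx0.
by rewrite scalerN opprK oppr0.
Qed.

Let UU (t : K) : (U t)^T *m U t = 1%:M.
Proof.
rewrite trmx_mul -mulmxA [_^T *m (row_mx _ _ *m _)]mulmxA.
have -> : (row_mx Yt Q)^T *m row_mx Yt Q = 1%:M.
  rewrite tr_row_mx mul_col_row YY QQ YQ.
  by rewrite -[Q^T *m Yt]trmxK trmx_mul trmxK YQ trmx0 -scalar_mx_block.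
by rewrite mul1mx expmx_orthogonal.
Qed.

Let WW (t : K) : (W t)^T *m W t = 1%:M.
Proof. by rewrite expmx_orthogonal// /antisym trmxZ AA scalerN. Qed.

(** Curves here are a constant [M] between the moving factors [U] and [W], and differentiation acts
    on [M] alone. It takes [Ipk] to [C], because 2 alpha + beta = 1, and [C] to the coefficient of
    the acceleration. *)
Let is_derive_frame (M : 'M[K]_(p + k, p)) (t : K) :
  is_derive t 1 (fun s => U s *m M *m W s)
    (U t *m (Ahat *m M + M *m (beta *: A)) *m W t).
Proof.
apply: is_derive_eq.
  apply: is_derive_mulmx (is_derive_expmx_scale _ t).
  exact: is_derive_mulmxr (is_derive_mulmxl _ (is_derive_expmx_scaler _ t)).
by rewrite [U t *m (_ + _)]mulmxDr mulmxDl !mulmxA.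
Qed.

Let is_derive_c (t : K) : is_derive t 1 c (U t *m C *m W t).
Proof.
have := is_derive_frame Ipk t; congr is_derive; congr (_ *m _ *m _).
rewrite mul_block_col mul_col_mx !mulmx1 !mulmx0 mul1mx mul0mx !addr0 add_col_mx addr0.
by rewrite -scalerDl addrC subrK scale1r.
Qed.

Let is_derive_c' (t : K) : is_derive t 1 (c^`()%classic)
  (U t *m (Ahat *m C + C *m (beta *: A)) *m W t).
Proof.
rewrite (_ : c^`()%classic = fun s => U s *m C *m W s); first exact: is_derive_frame.
by apply/funext => s; exact: derive1_is_derive.
Qed.

Let IC : Ipk^T *m C = A.
Proof. by rewrite tr_col_mx mul_row_col trmx1 trmx0 mul1mx mul0mx addr0. Qed.

Let CI : C^T *m Ipk = A^T.
Proof. by rewrite -[LHS]trmxK trmx_mul trmxK IC. Qed.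

Let II : Ipk^T *m Ipk = 1%:M.
Proof. by rewrite tr_col_mx mul_row_col trmx1 trmx0 mul1mx mul0mx addr0. Qed.

Let frame_mul (M N : 'M[K]_(p + k, p)) (t : K) :
  (U t *m M *m W t)^T *m (U t *m N *m W t) = (W t)^T *m (M^T *m N) *m W t.
Proof.
have := UU t; move: (U t) (W t) => u w uu.
by rewrite !trmx_mul -!mulmxA [u^T *m (u *m _)]mulmxA uu mul1mx.
Qed.

Lemma stiefel_geodesic_stiefel t : stiefel (c t).
Proof. by rewrite /stiefel frame_mul II mulmx1 WW. Qed.

(** This is the geodesic equation once [U t] on the left and [W t] on the right are factored out. *)
Let geodesic_algebra : Ahat *m C + C *m (beta *: A) + Ipk *m (C^T *m C) +
  (2 * (1 - alpha)) *: ((C - Ipk *m A) *m A^T) = 0.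
Proof.
have -> : Ahat *m C = col_mx ((2 * alpha) *: (A *m A) - R^T *m R) (R *m A).
  by rewrite mul_block_col mul0mx addr0 mulNmx scalemxAl.
have -> : C *m (beta *: A) = col_mx (beta *: (A *m A)) (beta *: (R *m A)).
  by rewrite mul_col_mx !scalemxAr.
have -> : Ipk *m (C^T *m C) = col_mx (R^T *m R - A *m A) 0.
  by rewrite mul_col_mx mul1mx mul0mx tr_col_mx mul_row_col AA mulNmx addrC.
have -> : (C - Ipk *m A) *m A^T = col_mx 0 (- (R *m A)).
  by rewrite mul_col_mx mul1mx mul0mx opp_col_mx add_col_mx subrr subr0 mul_col_mx
    mul0mx AA mulmxN.
rewrite scale_col_mx !add_col_mx -[RHS]col_mx0.
move: (A *m A) (R^T *m R) (R *m A) => x y z; congr col_mx;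
  by apply/matrixP => i j; rewrite !mxE; ring.
Qed.

Lemma is_geodesic_stiefel_geodesic : is_geodesic alpha0 alpha1 c.
Proof.
split; first exact: stiefel_geodesic_stiefel.
  move=> t; split; first exact: (@ex_derive _ _ _ _ _ _ _ (is_derive_c t)).
  exact: (@ex_derive _ _ _ _ _ _ _ (is_derive_c' t)).
exists (christoffel alpha0 alpha1); first exact: levi_civita_christoffel.
move=> t; rewrite (derive1_is_derive (is_derive_c' t)).
rewrite (derive1_is_derive (is_derive_c t)) christoffel_diag.
have -> : c t *m ((U t *m C *m W t)^T *m (U t *m C *m W t)) =
    U t *m (Ipk *m (C^T *m C)) *m W t.
  rewrite frame_mul /stiefel_geodesic; have := mulmx1C (WW t).
  move: (U t) (W t) => u w ww.
  by rewrite -!mulmxA [w *m (w^T *m _)]mulmxA ww mul1mx.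
have -> : (U t *m C *m W t)^T *m c t = (W t)^T *m A^T *m W t.
  by rewrite frame_mul CI.
have -> : (1%:M - c t *m (c t)^T) *m (U t *m C *m W t *m ((W t)^T *m A^T *m W t)) =
    U t *m ((C - Ipk *m A) *m A^T) *m W t.
  have -> : U t *m C *m W t *m ((W t)^T *m A^T *m W t) =
            U t *m (C *m A^T) *m W t.
    have := mulmx1C (WW t); move: (U t) (W t) => u w ww.
    by rewrite -!mulmxA [w *m (w^T *m _)]mulmxA ww mul1mx.
  rewrite mulmxBl mul1mx -[c t *m _ *m _]mulmxA frame_mul [Ipk^T *m _]mulmxA IC.
  have -> : c t *m ((W t)^T *m (A *m A^T) *m W t) = U t *m (Ipk *m A *m A^T) *m W t.
    rewrite /stiefel_geodesic; have := mulmx1C (WW t).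
    move: (U t) (W t) => u w ww.
    by rewrite -!mulmxA [w *m (w^T *m _)]mulmxA ww mul1mx.
  by rewrite -mulmxBl -mulmxBr -mulmxBl.
rewrite [_ *: (_ *m W t)]scalemxAl [_ *: (U t *m _)]scalemxAr -!mulmxDl -!mulmxDr.
by rewrite !addrA geodesic_algebra mulmx0 mul0mx.
Qed.

(** The explicit curve shows that the set is inhabited, so [get] returns a geodesic with these
    initial data, and uniqueness identifies it. *)
Lemma geodesicE t : geodesic alpha0 alpha1 Yt (Yt *m A + Q *m R) t = c t.
Proof.
have c0 : c 0 = Yt.
  rewrite /stiefel_geodesic !scale0r !expmx0 !mulmx1 mul_row_col mulmx1 mulmx0.
  by rewrite addr0.
have c'0 : c^`()%classic 0 = Yt *m A + Q *m R.
  rewrite (derive1_is_derive (is_derive_c 0)) !scale0r !expmx0 !mulmx1.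
  by rewrite mul_row_col.
have cP : [set c | [/\ is_geodesic alpha0 alpha1 c, c 0 = Yt &
    derive1 c 0 = Yt *m A + Q *m R]] c.
  by split => //; exact: is_geodesic_stiefel_geodesic.
have [gG g0 g'0] := getPex (ex_intro _ c cP).
rewrite -/(geodesic _ _ _ _) in gG g0 g'0.
by rewrite (geodesic_unique a0 a1 gG is_geodesic_stiefel_geodesic) ?g0 ?g'0.
Qed.

End ExplicitGeodesic.

(** * The gradient *)

Section Objective.
Context {K : realType} {n p k : nat}.
Variables (a : K) (P : 'M[K]_(p, p + k)).
Local Notation beta := (1 - 2 * a).
Local Notation Ipk := (@col_mx K p k p 1%:M 0).
Local Notation Jpk := (@col_mx K p k k 0 1%:M).
Implicit Types x v H : 'M[K]_p * 'M[K]_(k, p).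

Definition hat_mx x : 'M[K]_(p + k) := block_mx ((2 * a) *: x.1) (- x.2^T) x.2 0.

(** [P] stands for Z^T [Yt Q]. No antisymmetry is imposed on [x.1], so ordinary calculus applies on
    the whole product space. *)
Definition objective x : K :=
  - \tr (P *m expmx (hat_mx x) *m Ipk *m expmx (beta *: x.1)).

(** Products with constant matrices replace the blocks so that the differentiability rules for
    products apply. *)
Lemma hat_mxE x : hat_mx x = Ipk *m ((2 * a) *: x.1) *m Ipk^T +
  (Jpk *m x.2 *m Ipk^T - (Jpk *m x.2 *m Ipk^T)^T).
Proof.
have E1 (M : 'M[K]_p) : Ipk *m M *m Ipk^T = block_mx M 0 0 0.
  rewrite mul_col_mx mul1mx mul0mx tr_col_mx trmx1 trmx0 mul_col_row.
  by rewrite !(mulmx1, mulmx0, mul0mx).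
have E2 (M : 'M[K]_(k, p)) : Jpk *m M *m Ipk^T = block_mx 0 0 M 0.
  rewrite mul_col_mx mul1mx mul0mx tr_col_mx trmx1 trmx0 mul_col_row.
  by rewrite !(mulmx1, mulmx0, mul0mx).
rewrite E1 E2 tr_block_mx !trmx0 opp_block_mx !add_block_mx.
by rewrite !oppr0 !addr0 !add0r.
Qed.

Lemma differentiable_fst x : differentiable (fun y : 'M[K]_p * 'M[K]_(k, p) => y.1) x.
Proof.
by apply: linear_differentiable => y; exact: cvg_fst.
Qed.

Lemma differentiable_snd x : differentiable (fun y : 'M[K]_p * 'M[K]_(k, p) => y.2) x.
Proof.
by apply: linear_differentiable => y; exact: cvg_snd.
Qed.

Lemma differentiable_hat_mx x : differentiable hat_mx x.
Proof.
rewrite (_ : hat_mx = fun x => Ipk *m ((2 * a) *: x.1) *m Ipk^T +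
  (Jpk *m x.2 *m Ipk^T - (Jpk *m x.2 *m Ipk^T)^T)); last first.
  by apply/funext => y; exact: hat_mxE.
have cd q r (M : 'M[K]_(q, r)) : differentiable (fun=> M) x by exact: differentiable_cst.
apply: differentiableD.
  apply: (differentiable_mulmx (differentiable_mulmx (cd _ _ _) _) (cd _ _ _)).
  exact/differentiableZ/differentiable_fst.
have d2 : differentiable (fun x => Jpk *m x.2 *m Ipk^T) x.
  apply: (differentiable_mulmx (differentiable_mulmx (cd _ _ _) _) (cd _ _ _)).
  exact: differentiable_snd.
apply: differentiableB => //.
exact: differentiable_trmx.
Qed.

Lemma differentiable_objective x : differentiable objective x.
Proof.
have cd q r (M : 'M[K]_(q, r)) : differentiable (fun=> M) x by exact: differentiable_cst.
apply: differentiableN; apply: differentiable_mxtrace.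
apply: differentiable_mulmx; last first.
  apply: (differentiable_comp (f := fun x => beta *: x.1)) (differentiable_expmx _).
  exact/differentiableZ/differentiable_fst.
apply: (differentiable_mulmx (differentiable_mulmx (cd _ _ _) _) (cd _ _ _)).
exact: (differentiable_comp (differentiable_hat_mx x) (differentiable_expmx _)).
Qed.

(** Cyclicity gathers the other factors on one side of each differential of exp, and
    self-adjointness moves the differential onto them. The direction is left as a linear factor,
    from which the gradient can be read. *)
Lemma is_derive_objective x v : is_derive x v objective
  (- (\tr (hat_mx v *m dexp (hat_mx x) (Ipk *m expmx (beta *: x.1) *m P)) +
      beta * \tr (v.1 *m dexp (beta *: x.1) (P *m expmx (hat_mx x) *m Ipk)))).
Proof.
have d1 : is_derive x v (fun y => expmx (hat_mx y)) (dexp (hat_mx x) (hat_mx v)).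
  apply: (is_derive_affine_comp (w := hat_mx v)) (is_derive_expmx _ _) => h.
  rewrite /hat_mx/= scale_block_mx add_block_mx !trmxD !trmxZ scaler0 addr0.
  by rewrite !scalerDr !scalerA [2 * a * h]mulrC opprD scalerN.
have d2 : is_derive x v (fun y => expmx (beta *: y.1)) (dexp (beta *: x.1) (beta *: v.1)).
  apply: (is_derive_affine_comp (L := fun y => beta *: y.1) (w := beta *: v.1))
    (is_derive_expmx _ _) => h.
  by rewrite /= scalerDr !scalerA mulrC.
have := is_derive_mulmx (is_derive_mulmxr Ipk (is_derive_mulmxl P d1)) d2.
move=> /is_derive_mxtrace/is_deriveN; congr is_derive; congr (- _).
rewrite mxtraceD; congr (_ + _).
  rewrite -!mulmxA mxtrace_mulC -!mulmxA mxtrace_dexp.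
  by rewrite !mulmxA.
by rewrite mxtrace_mulC mxtrace_dexp -scalemxAl mxtraceZ.
Qed.

End Objective.

(** * From the differential to the gradient on antisymmetric pairs *)

Lemma mx_norm_le_frobenius (K : realType) m n (M : 'M[K]_(m, n)) :
  `|M| <= Num.sqrt (\tr (M^T *m M)).
Proof.
apply: mx_norm_le => [|i j]; first exact: sqrtr_ge0.
rewrite -sqrtr_sqr ler_sqrt ?mxtrace_normsq_ge0// mxtrace_normsq.
rewrite (bigD1 j)//= (bigD1 i)//= -addrA lerDl addr_ge0//.
  by apply: sumr_ge0 => l _; exact: sqr_ge0.
by apply: sumr_ge0 => l _; apply: sumr_ge0 => l' _; exact: sqr_ge0.
Qed.

(** The little-o estimate comes in the max norm of the product space, the gradient asks for the
    Frobenius norm. *)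
Lemma norm_le_inner (K : realType) p k (H : 'M[K]_p * 'M[K]_(k, p)) :
  `|H| <= Num.sqrt (inner H H).
Proof.
rewrite [leLHS]/Num.norm/= /inner ge_max; apply/andP; split;
  apply: (le_trans (mx_norm_le_frobenius _));
  rewrite ler_sqrt ?addr_ge0 ?mxtrace_normsq_ge0//.
- by rewrite lerDl mxtrace_normsq_ge0.
- by rewrite lerDr mxtrace_normsq_ge0.
Qed.

(** Antisymmetric increments keep [x + H] where [F] and [f] agree, so the expansion of [f] transfers
    to [F]. *)
Lemma is_gradient_diff (K : realType) p k
    (F f : 'M[K]_p * 'M[K]_(k, p) -> K) x G :
    antisym x.1 -> antisym G.1 ->
    (forall y, antisym y.1 -> F y = f y) -> differentiable f x ->
    (forall H, antisym H.1 -> 'd f x H = inner G H) ->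
  is_gradient F x G.
Proof.
move=> xA GA Ff fd dG; split => // e e0.
have [_ /eqaddoP/(_ e e0) fx] := (diff_locallyP x f).1 fd.
rewrite near_withinE; near=> H => HA.
have xHA : antisym (x + H).1 by rewrite /antisym /= trmxD xA HA opprD.
rewrite (Ff _ xHA) (Ff _ xA) -(dG _ HA).
have : `|f (H + x) - (f x + 'd f x H)| <= e * `|H| by near: H; exact: fx.
rewrite [H + x]addrC opprD addrA => /le_trans; apply.
by rewrite ler_wpM2l ?(ltW e0)// norm_le_inner.
Unshelve. all: by end_near. Qed.

(** Against an antisymmetric [N] only the antisymmetric part of [M] counts, and transposing it costs
    a sign, which later matches the leading minus of [objective]. *)
Lemma mxtrace_skew_part (K : realType) (p : nat) (M N : 'M[K]_p) :
  antisym N -> \tr ((skew_part M)^T *m N) = - \tr (N *m M).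
Proof.
move=> NA; rewrite /skew_part trmxZ trmxB trmxK -scalemxAl mulmxBl mxtraceZ raddfB/=.
rewrite -[\tr (M^T *m N)]mxtrace_tr trmx_mul trmxK NA mulNmx mxtraceN.
rewrite [\tr (M *m N)]mxtrace_mulC; lra.
Qed.

Lemma antisym_skew_part (K : realType) (p : nat) (M : 'M[K]_p) :
  antisym (skew_part M).
Proof. by rewrite /antisym /skew_part trmxZ trmxB trmxK -scalerN opprB. Qed.

Lemma antisym_skew_part_comb (K : realType) (p : nat) (a b : K) (M N : 'M[K]_p) :
  antisym (a *: skew_part M + b *: skew_part N).
Proof.
have := antisym_skew_part M; have := antisym_skew_part N.
move: (skew_part M) (skew_part N) => x y yA xA.
by rewrite /antisym trmxD !trmxZ xA yA !scalerN opprD.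
Qed.

Lemma mxtrace_skew_part_comb (K : realType) (p : nat) (a b : K)
    (M N H : 'M[K]_p) : antisym H ->
  \tr ((a *: skew_part M + b *: skew_part N)^T *m H) =
  - (a * \tr (H *m M) + b * \tr (H *m N)).
Proof.
move=> HA; have := mxtrace_skew_part M HA; have := mxtrace_skew_part N HA.
move: (skew_part M) (skew_part N) => x y yE xE.
by rewrite trmxD !trmxZ mulmxDl -!scalemxAl mxtraceD !mxtraceZ xE yE; ring.
Qed.

Unset Implicit Arguments.

Theorem theorem2 (K : realType) (n p k : nat) (alpha0 alpha1 : K)
    (Yt Z : 'M[K]_(n, p)) (Q : 'M[K]_(n, k))
    (halpha0 : 0 < alpha0) (halpha1 : 0 < alpha1)
    (hYt : stiefel Yt) (hZ : stiefel Z)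
    (hQ : Q^T *m Q = 1%:M)
    (hQspan : (Q^T == (Z - Yt *m Yt^T *m Z)^T)%MS)
    (A : 'M[K]_p) (R : 'M[K]_(k, p)) (hA : antisym A) :
  let alpha := alpha1 / alpha0 in
  let Y1 (x : 'M[K]_p * 'M[K]_(k, p)) : 'M[K]_(n, p) :=
    geodesic alpha0 alpha1 Yt (Yt *m x.1 + Q *m x.2) 1 in
  let F (x : 'M[K]_p * 'M[K]_(k, p)) : K :=
    2^-1 * \tr ((Y1 x - Z)^T *m (Y1 x - Z)) - p%:R in
  let Ahat : 'M[K]_(p + k) := block_mx ((2 * alpha) *: A) (- R^T) R 0 in
  let Ipk : 'M[K]_(p + k, p) := col_mx 1%:M 0 in
  let expA : 'M[K]_p := expmx ((1 - 2 * alpha) *: A) in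
  let Lring : 'M[K]_p :=
    Lexp ((1 - 2 * alpha) *: A) (Z^T *m row_mx Yt Q *m expmx Ahat *m Ipk) in
  let Lhat : 'M[K]_(p + k) :=
    Lexp Ahat (Ipk *m expA *m Z^T *m row_mx Yt Q) in
  [/\ F (A, R) = - \tr (Z^T *m Y1 (A, R)),
      - \tr (Z^T *m Y1 (A, R)) =
        - \tr (Z^T *m row_mx Yt Q *m expmx Ahat *m Ipk *m expA) &
      is_gradient F (A, R)
        ((1 - 2 * alpha) *: skew_part Lring + (2 * alpha) *: skew_part (ulsubmx Lhat),
         dlsubmx Lhat - (ursubmx Lhat)^T)].
Proof.
move=> alpha Y1 F Ahat Ipk expA Lring Lhat.
(* The columns of [Q] are combinations of those of Z - Yt Yt^T Z, which Yt^T annihilates. *)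
have YQ : Yt^T *m Q = 0.
  case/andP: hQspan => /submxP[D QD] _.
  rewrite -[Q]trmxK QD trmx_mul trmxK mulmxA mulmxBr.
  by rewrite !mulmxA hYt mul1mx subrr mul0mx.
have Y1E x : antisym x.1 -> Y1 x = stiefel_geodesic alpha0 alpha1 Yt Q x.1 x.2 1.
  by move=> xA; rewrite /Y1 geodesicE.
(* Y^T Y and Z^T Z both have trace [p], so half the squared distance is p - tr (Z^T Y). *)
have FE x : antisym x.1 -> F x = - \tr (Z^T *m Y1 x).
  move=> xA; have YY : (Y1 x)^T *m Y1 x = 1%:M.
    by rewrite Y1E//; exact: stiefel_geodesic_stiefel.
  rewrite /F; move: (Y1 x) YY => Y YY.
  rewrite trmxB mulmxBl !mulmxBr YY hZ !raddfB/= mxtrace1.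
  have -> : \tr (Y^T *m Z) = \tr (Z^T *m Y).
    by rewrite -mxtrace_tr trmx_mul trmxK.
  lra.
have YphiE x : antisym x.1 ->
    - \tr (Z^T *m Y1 x) = objective alpha (Z^T *m row_mx Yt Q) x.
  move=> xA; rewrite Y1E// /objective /stiefel_geodesic /hat_mx !scale1r.
  by rewrite !mulmxA.
split; [exact: FE|exact: (YphiE (A, R))|].
apply: (@is_gradient_diff _ _ _ _ (objective alpha (Z^T *m row_mx Yt Q))).
- exact: hA.
- exact: antisym_skew_part_comb.
- by move=> y yA; rewrite FE// YphiE.
- exact: differentiable_objective.
move=> H HA; rewrite -deriveE; last exact: differentiable_objective.
rewrite (@derive_val _ _ _ _ _ _ _ (is_derive_objective _ _ _ _)) /=.
rewrite -[hat_mx alpha (A, R)]/Ahat -/Ipk -/expA !mulmxA -!LexpE -/Lring -/Lhat.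
rewrite /inner/= mxtrace_skew_part_comb// trmxB trmxK mulmxBl raddfB/=.
(* The trace is expanded by blocks; the zero block of [hat_mx] leaves only three blocks of
   [Lhat]. *)
rewrite -{1}[Lhat]submxK /hat_mx mulmx_block mxtrace_block !mul0mx addr0.
rewrite !mxtraceD mulNmx mxtraceN -scalemxAl mxtraceZ.
have -> : \tr ((dlsubmx Lhat)^T *m H.2) = \tr (H.2^T *m dlsubmx Lhat).
  by rewrite -mxtrace_tr trmx_mul trmxK.
rewrite [\tr (ursubmx Lhat *m H.2)]mxtrace_mulC.
move: (\tr _) (\tr _) (\tr _) (\tr _) => t1 t2 t3 t4.
ring.
Qed.
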